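(* Let $r\geq 3$, $k_1\geq k_2\geq\cdots\geq k_r\geq t+2$ and $n\geq 5-k_1+2k_1\log_2 k_1$. If $\mathcal{F}_1\subseteq\Pi(n,k_1),\ldots,\mathcal{F}_r\subseteq\Pi(n,k_r)$ are non-trivial $r$-cross $t$-intersecting, then $$\prod_{i=1}^r|\mathcal{F}_i|\leq\Big((t+1)S(n-t,k_r-t)-t\,S(n-t-1,k_r-t-1)\Big)\prod_{i=1}^{r-1}S(n-t-1,k_i-t-1).$$ If equality holds, then there are $a\in[r]$ with $k_a=k_r$ and a partition $T$ consisting of $t+1$ singletons such that $\mathcal{F}_a=\{F\in\Pi(n,k_a):|T\cap F|\geq t\}$ and $\mathcal{F}_i=\{F\in\Pi(n,k_i):T\subseteq F\}$ for each $i\in[r]\setminus\{a\}$.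
   Context: All letters denote positive integers. $[n]=\{1,\ldots,n\}$. A partition is a set of pairwise disjoint nonempty sets (blocks). $\Pi(n,k)$ is the set of all partitions of $[n]$ into $k$ blocks; $S(n,k)=|\Pi(n,k)|$ (Stirling number of the second kind), with $S(n,a)=0$ for $a\leq 0$. For partitions $F,G$, $F\cap G$ is the set of common blocks. Families $\mathcal{F}_i\subseteq\Pi(n,k_i)$, $i\in[r]$, are $r$-cross $t$-intersecting if $|F_1\cap\cdots\cap F_r|\geq t$ for all $F_i\in\mathcal{F}_i$; they are non-trivial if the set of blocks belonging to every member of every $\mathcal{F}_i$ has fewer than $t$ elements. *)

(* Defs.v *)
From mathcomp Require Import all_boot.
From Stdlib Require Reals.

Set Implicit Arguments.
Unset Strict Implicit.
Unset Printing Implicit Defensive.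

(* [n] is modelled by 'I_n = {0,...,n-1}; a block is a {set 'I_n};
   a partition of [n] is a set of blocks which is a MathComp [partition]
   of the whole set (pairwise disjoint, nonempty blocks, covering [n]). *)
Definition Pi (n k : nat) : {set {set {set 'I_n}}} :=
  [set P : {set {set 'I_n}} | partition P [set: 'I_n] & #|P| == k].

Definition stirling (n k : nat) : nat := #|Pi n k|.

Definition cross_intersecting (n r t : nat)
  (F : nat -> {set {set {set 'I_n}}}) : Prop :=
  forall G : nat -> {set {set 'I_n}},
    (forall i, 1 <= i <= r -> G i \in F i) ->
    t <= #|\bigcap_(1 <= i < r.+1) G i|.

Definition common_blocks (n r : nat) (F : nat -> {set {set {set 'I_n}}})
  : {set {set 'I_n}} :=
  [set B : {set 'I_n} | all (fun i => [forall G in F i, B \in G]) (iota 1 r)].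

Definition nontrivial (n r t : nat) (F : nat -> {set {set {set 'I_n}}}) : Prop :=
  #|common_blocks r F| < t.

Definition log_cond (n k1 : nat) : Prop :=
  (Rdefinitions.Rle
     (Rdefinitions.Rplus
        (Rdefinitions.Rminus (Raxioms.INR 5) (Raxioms.INR k1))
        (Rdefinitions.Rmult (Rdefinitions.Rmult (Raxioms.INR 2) (Raxioms.INR k1))
           (Rdefinitions.Rdiv (Rpower.ln (Raxioms.INR k1)) (Rpower.ln (Raxioms.INR 2)))))
     (Raxioms.INR n)).

(* Main.v *)
(** Count the members of [Pi n k] containing [s] given blocks: there are at most
    [S(n-s, k-s)], and the hypothesis on [n] makes each further block cost a factor of at least
    [2 * K ^ 2], where [K = k 1].

    Call a set of blocks a [t]-cover of a family if it shares at least [t] blocks with every member.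
    Split the index set in two parts; each common intersection over one part is a [t]-cover of the
    other. If the minimum [t]-covers of the two sides have [t + x] and [t + z] blocks, then choosing
    [t] blocks inside the minimum cover of one side and extending them one block at a time, by blocks
    of a member of the other side missed so far, bounds the number of choices on each side.
    If some family [a] has no common [t]-set, the remaining families are [(t+1)]-cross-intersecting,
    hence have at most [prod S(n-t-1, k_i-t-1)] choices; the family [a] then has either too few
    members, or all of its members share [t] blocks with one [(t+1)]-set contained in all other members, which is the
    extremal configuration. If every family has a common [t]-set, non-triviality forces the
    product below [K ^ 2 * prod S(n-t-1, k_i-t-1)], which is less than the bound.

    Families with [k_i = t + 2] need separate care because [t + 1] blocks already determine a
    partition, so the factor [2 * K ^ 2] is lost at the last step.

    Log-concavity of [l! * S(N, l)] shows that the distinguished family should have the least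
    [k_i]. *)
Require Import Defs.
From mathcomp Require Import all_boot zify.
From Stdlib Require Import Lra.
From Stdlib Require Reals.

Set Implicit Arguments.
Unset Strict Implicit.
Unset Printing Implicit Defensive.

(** * Growth of Stirling numbers *)

Section LogCondition.
Import Reals.

(* [Reals] rebinds this notation to [Nat.pow]. *)
Local Notation "m ^ n" := (expn m n) : nat_scope.

Local Lemma INR_expn m e : INR (m ^ e) = (INR m ^ e)%R.
Proof.
elim: e => [|e IHe]; first by [].
by rewrite expnS -multE mult_INR IHe.
Qed.

(** Multiplying by [ln 2] and exponentiating turns the condition into an inequality between natural
    numbers, the only form in which it is used later. *)
Lemma log_cond_pow n K : 0 < K -> log_cond n K -> 32 * K ^ (2 * K) <= 2 ^ (n + K).
Proof.
move=> K_gt0 hlog; rewrite leqNgt; apply/negP => /ltP /lt_INR.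
have K0 : (0 < INR K)%R by apply: lt_0_INR; apply/ltP.
have two0 : (0 < INR 2)%R by simpl; lra.
rewrite -[32]/(2 ^ 5) -multE mult_INR !INR_expn => lt.
have p0 : (0 < INR 2 ^ (n + K))%R by apply: pow_lt.
have := ln_increasing _ _ p0 lt.
rewrite ln_mult; [|exact: pow_lt|exact: pow_lt].
rewrite !ln_pow // mult_INR -plusE plus_INR.
have L2 : (0 < ln (INR 2))%R.
  by rewrite -ln_1; apply: ln_increasing; simpl; lra.
move: hlog; rewrite /log_cond => /(Rmult_le_compat_r _ _ _ (Rlt_le _ _ L2)).
have -> : ((INR 5 - INR K + INR 2 * INR K * (ln (INR K) / ln (INR 2))) * ln (INR 2) =
   INR 5 * ln (INR 2) - INR K * ln (INR 2) + INR 2 * INR K * ln (INR K))%R.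
  by field; lra.
by move=> h1 h2; lra.
Qed.
End LogCondition.

Lemma leq_expl m n e : m <= n -> m ^ e <= n ^ e.
Proof. by case: e => [|e] mn; rewrite ?expn0 // leq_exp2r. Qed.

(** Stirling numbers of the second kind by their recurrence; [card_parts] later identifies them with
    counts of partitions. *)
Fixpoint s2 n k := match n, k with
  | 0, 0 => 1
  | n'.+1, k'.+1 => k * s2 n' k + s2 n' k'
  | _, _ => 0
  end.

Lemma s2S n k : s2 n.+1 k.+1 = k.+1 * s2 n k.+1 + s2 n k. Proof. by []. Qed.

Lemma s2_n0 n : s2 n.+1 0 = 0. Proof. by []. Qed.

Arguments s2 : simpl never.

Lemma s2_gt n k : n < k -> s2 n k = 0.
Proof.
elim: n k => [|n IHn] [|k] //; rewrite ltnS => nk.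
by rewrite s2S !IHn ?muln0 // ltnW.
Qed.

Lemma s2_gt0 n k : 0 < k <= n -> 0 < s2 n k.
Proof.
elim: n k => [|n IHn] [|k] // kn; rewrite s2S; case: (leqP k.+1 n) => h.
  by have := IHn k.+1 h; lia.
have -> : k = n by lia.
case: n {h kn} IHn => // n IHn; have := IHn n.+1 (leqnn _); lia.
Qed.

Lemma s2_1 n : s2 n.+1 1 = 1.
Proof. by elim: n => // n IHn; rewrite s2S IHn. Qed.

Lemma s2_2 n : s2 n.+1 2 = 2 ^ n - 1.
Proof.
elim: n => // n IHn; rewrite s2S IHn s2_1 expnS.
have := expn_gt0 2 n; lia.
Qed.

Lemma leq_s2S n k : 0 < k -> s2 n k <= s2 n.+1 k.
Proof. by case: k => // k _; rewrite s2S; nia. Qed.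

Lemma leq_s2 m n k : 0 < k -> m <= n -> s2 m k <= s2 n k.
Proof.
move=> k_gt0 /subnKC <-; elim: (n - m) => [|d IHd]; first by rewrite addn0.
by rewrite addnS; apply: leq_trans IHd (leq_s2S _ k_gt0).
Qed.

Lemma s2_double n k : 1 < k -> 2 * s2 n k <= s2 n.+1 k.
Proof. by case: k => // k k_gt1; rewrite s2S; nia. Qed.

(** The smaller summand is at most the larger, and one extra point at least doubles the value. For
    [p' = 1] the second summand vanishes because [l > 1]. *)
Lemma s2_superadd p p' l : 1 < l -> 0 < p -> 0 < p' -> s2 p l + s2 p' l <= s2 (p + p' - 1) l.
Proof.
move=> l_gt1; wlog le : p p' / p' <= p => [H|] p_gt0 p'_gt0.
  case: (leqP p' p) => [/H|/ltnW/H]; first by apply.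
  by rewrite addnC [p + _]addnC; apply.
case: (leqP p' 1) => p'1.
  have -> : p' = 1 by lia.
  by rewrite [s2 1 l]s2_gt // addn0 addnK.
apply: (@leq_trans (s2 p.+1 l)); last by apply: leq_s2; lia.
apply: leq_trans (s2_double _ l_gt1).
by have := @leq_s2 p' p l; lia.
Qed.

(** * Numbers of surjections and their log-concavity *)

Definition surj N l := l`! * s2 N l.

Lemma surjS N l : surj N.+1 l.+1 = l.+1 * (surj N l.+1 + surj N l).
Proof. by rewrite /surj s2S factS; lia. Qed.

Lemma surj_S0 N : surj N.+1 0 = 0. Proof. by []. Qed.

Lemma surj_gt0 N l : 0 < l <= N -> 0 < surj N l.
Proof. by move=> h; rewrite muln_gt0 fact_gt0 s2_gt0. Qed.

(** Log-concavity passes to sums of adjacent terms: after expansion, one product is common to both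
    sides, two are compared by single instances of the hypothesis, and the last by two chained
    instances. *)
Lemma surj_pair N i j :
    (forall i j, i <= j -> surj N i * surj N j.+1 <= surj N i.+1 * surj N j) ->
  i <= j ->
  (surj N i.+1 + surj N i) * (surj N j.+2 + surj N j.+1)
    <= (surj N i.+2 + surj N i.+1) * (surj N j.+1 + surj N j).
Proof.
move=> LC ij; have h1 := LC i.+1 j.+1; have h2 := LC i j ij.
have h3 : surj N i * surj N j.+2 <= surj N i.+2 * surj N j.
  move: ij; rewrite leq_eqVlt => /orP[/eqP ->|ij]; first by rewrite mulnC.
  apply: leq_trans (LC _ _ _) (LC _ _ ij); lia.
move: h1; rewrite ltnS => /(_ ij).
rewrite !mulnDl !mulnDr; lia.
Qed.

(** By [surjS] each row consists of the adjacent sums of the previous row multiplied by [l.+1], and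
    these multipliers satisfy [i.+1 * j.+2 <= i.+2 * j.+1]. *)
Lemma surj_log_concave N i j : i <= j -> surj N i * surj N j.+1 <= surj N i.+1 * surj N j.
Proof.
elim: N i j => [|N IHN] i j ij; first by rewrite /surj [s2 0 j.+1]s2_gt // !muln0.
case: i j ij => [|i] [|j] ij //; rewrite ?surj_S0 ?mul0n ?muln0 //.
rewrite !surjS; rewrite ltnS in ij.
have h := surj_pair IHN ij.
have e : i.+1 * j.+2 <= i.+2 * j.+1 by nia.
rewrite mulnACA [leqRHS]mulnACA; exact: leq_mul.
Qed.

Lemma surj_log_concave_lt N i j : i < j <= N -> surj N i * surj N j.+1 < surj N i.+1 * surj N j.
Proof.
case: N => [|N]; first by case: j => // j; rewrite andbF.
case: i j => [|i] [|j] // /andP[ij jN].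
  by rewrite surj_S0 mul0n muln_gt0 !surj_gt0.
rewrite !surjS mulnACA [ltnRHS]mulnACA.
have h : (surj N i.+1 + surj N i) * (surj N j.+2 + surj N j.+1)
    <= (surj N i.+2 + surj N i.+1) * (surj N j.+1 + surj N j).
  by apply: surj_pair; [apply: surj_log_concave | lia].
have p1 : 0 < surj N i.+1 by apply: surj_gt0; lia.
have p2 : 0 < surj N j by apply: surj_gt0; lia.
apply: leq_ltn_trans (leq_mul (leqnn _) h) _.
rewrite ltn_pmul2r; first by nia.
by rewrite muln_gt0; lia.
Qed.

Lemma surj_fact N i j : surj N i * surj N j.+1 = i`! * j`! * (s2 N i * (j.+1 * s2 N j.+1)).
Proof. by rewrite /surj factS; lia. Qed.

(** By the recurrence, [S(N+1, j+1) / S(N, j) = 1 + surj N j.+1 / surj N j], and log-concavity makes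
    the last quotient non-increasing in [j]. *)
Lemma s2_ratio_le N i j : i <= j ->
  s2 N.+1 j.+1 * s2 N i <= s2 N.+1 i.+1 * s2 N j.
Proof.
move=> ij; have := surj_log_concave N ij.
rewrite [leqRHS]mulnC !surj_fact [j`! * i`!]mulnC leq_pmul2l ?muln_gt0 ?fact_gt0 // => h.
by rewrite !s2S (mulnDl (j.+1 * _)) (mulnDl (i.+1 * _)) [s2 N i * s2 N j]mulnC leq_add2r [leqLHS]mulnC [leqRHS]mulnC.
Qed.

Lemma s2_ratio_lt N i j : i < j <= N ->
  s2 N.+1 j.+1 * s2 N i < s2 N.+1 i.+1 * s2 N j.
Proof.
move=> ij; have := surj_log_concave_lt ij.
rewrite [ltnRHS]mulnC !surj_fact [j`! * i`!]mulnC ltn_pmul2l ?muln_gt0 ?fact_gt0 // => h.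
by rewrite !s2S (mulnDl (j.+1 * _)) (mulnDl (i.+1 * _)) [s2 N i * s2 N j]mulnC ltn_add2r [ltnLHS]mulnC [ltnRHS]mulnC.
Qed.

(** * Comparison of Stirling numbers with powers *)

Lemma expn_sum_s2 N l : l ^ N = \sum_(j < l.+1) s2 N j * l ^_ j.
Proof.
elim: N => [|N IHN].
  rewrite expn0 big_ord_recl big1 /= ?ffactn0 // => i _; by rewrite s2_gt.
rewrite expnS IHN big_distrr /=.
rewrite [RHS]big_ord_recl /= s2_n0 mul0n add0n.
have -> : \sum_(i < l) s2 N.+1 (bump 0 i) * l ^_ (bump 0 i) =
  \sum_(i < l) i.+1 * s2 N i.+1 * l ^_ i.+1 + \sum_(i < l) s2 N i * l ^_ i.+1.
  by rewrite -big_split /=; apply: eq_bigr => i _; rewrite /bump add1n s2S mulnDl.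
have -> : \sum_(i < l) i.+1 * s2 N i.+1 * l ^_ i.+1 = \sum_(i < l.+1) i * s2 N i * l ^_ i.
  by rewrite [RHS]big_ord_recl /= !mul0n add0n.
have -> : \sum_(i < l) s2 N i * l ^_ i.+1 = \sum_(i < l.+1) s2 N i * l ^_ i.+1.
  by rewrite [RHS]big_ord_recr /= ffact_small // muln0 addn0.
rewrite -big_split /=; apply: eq_bigr => i _; rewrite ffactnSr.
have := ltn_ord i; rewrite ltnS => il.
have -> : l * (s2 N i * l ^_ i) = s2 N i * l ^_ i * (i + (l - i)) by rewrite subnKC // mulnC.
rewrite mulnDr; lia.
Qed.

Lemma surj_le N l : surj N l <= l ^ N.
Proof. by rewrite expn_sum_s2 big_ord_recr /= ffactnn /surj mulnC leq_addl. Qed.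

(** A non-surjective map misses one of [l.+1] values, so there are at most [l.+1 * l ^ N] of them;
    here the two expansions by image size are compared term by term. *)
Lemma surj_ge N l : l.+1 ^ N <= surj N l.+1 + l.+1 * l ^ N.
Proof.
rewrite expn_sum_s2 big_ord_recr /= ffactnn /surj mulnC addnC leq_add2l.
rewrite expn_sum_s2 big_distrr /=; apply: leq_sum => j _.
rewrite mulnCA leq_mul2l; apply/orP; right.
rewrite -ffactSS ffactnSr leq_pmulr // subn_gt0; exact: ltn_ord.
Qed.

(** The bounds on [surj] give [c * surj N l <= surj N l.+1]; cancelling the factorial of [l] leaves
    [l.+1 * s2 N l.+1] on the right, one summand of the recurrence. *)
Lemma s2_step c N l : (c + l.+1) * l ^ N <= l.+1 ^ N -> c * s2 N l <= s2 N.+1 l.+1.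
Proof.
move=> h; have := surj_ge N l; have := surj_le N l => h1 h2.
have: c * surj N l <= surj N l.+1.
  have : c * surj N l <= c * l ^ N by rewrite leq_mul2l h1 orbT.
  rewrite mulnDl in h; lia.
rewrite /surj factS mulnCA [l.+1 * _]mulnC -mulnA leq_pmul2l ?fact_gt0 // s2S; lia.
Qed.

(** The first three terms of the binomial expansion of [m.+1 ^ e], with denominators cleared by
    [2 * m ^ 2]. *)
Lemma binomial3_le m e : m ^ e * (2 * m ^ 2 + 2 * e * m + e * (e - 1)) <= 2 * m ^ 2 * m.+1 ^ e.
Proof.
elim: e => [|e IHe]; first by rewrite !expn0; lia.
rewrite [m.+1 ^ _]expnS mulnCA.
apply: leq_trans (leq_mul (leqnn m.+1) IHe).
rewrite expnS -mulnA mulnCA [leqRHS]mulnCA leq_mul2l; apply/orP; right.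
rewrite -[m ^ 2]mulnn subn1 /=; case: e {IHe} => [|e]; rewrite ?subn1 /=; nia.
Qed.

(** Three binomial terms with exponent [m + 1] give [(1 + 1/m) ^ (m + 1) >= 1 + (3/2) * (1 + 1/m) >=
    5/2]. *)
Lemma exp_five_halves m : 5 * m ^ m.+1 <= 2 * m.+1 ^ m.+1.
Proof.
case: m => [|m]; first by rewrite exp0n.
have h := binomial3_le m.+1 m.+2.
rewrite -(@leq_pmul2l (m.+1 ^ 2)) ?expn_gt0 //.
have -> : m.+1 ^ 2 * (2 * m.+2 ^ m.+2) = 2 * m.+1 ^ 2 * m.+2 ^ m.+2 by lia.
apply: leq_trans h; rewrite mulnCA [leqLHS]mulnA [leqLHS]mulnC leq_mul2l.
apply/orP; right; rewrite -mulnn; nia.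
Qed.

Lemma exp_growth m N : 32 ^ N * m ^ (4 * m.+1 * N) <= m.+1 ^ (4 * m.+1 * N).
Proof.
rewrite !(expnM _ (4 * m.+1)) -expnMn; apply: leq_expl.
have := leq_expl 4 (exp_five_halves m); rewrite !expnMn -!expnM ![m.+1 * 4]mulnC.
by move: (m ^ _) (m.+1 ^ _) => x y; lia.
Qed.

(* [949] comes from [32 * (7/3) ^ 4 <= 949]; for [K >= 31] the claim is [949 <= K ^ 2]. *)
Lemma finite_growth_check K l : 3 <= K -> l <= K -> 949 ^ l <= 1024 * K ^ 10 * K ^ (2 * l).
Proof.
move=> K3 lK; case: (leqP 31 K) => [K31|K31].
  apply: (@leq_trans (K ^ (2 * l))); last by rewrite leq_pmull // muln_gt0 expn_gt0; lia.
  by rewrite expnM; apply: leq_expl; rewrite -mulnn; nia.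
(* For [K <= 30] one has [K ^ 2 <= 900 < 949], so [l = K] is the worst case, and the 28 remaining
   values of [K] are checked by computation. *)
suff h : 949 ^ K <= 1024 * K ^ 10 * K ^ (2 * K).
  have K_gt0 : 0 < K ^ (2 * (K - l)) by rewrite expn_gt0; lia.
  rewrite -(leq_pmul2r K_gt0) -[leqRHS]mulnA -expnD -mulnDr subnKC //.
  apply: leq_trans h; rewrite -[in leqRHS](subnKC lK) expnD leq_mul2l; apply/orP; right.
  by rewrite expnM; apply: leq_expl; rewrite -mulnn; nia.
move: K K3 K31 {l lK}.
do 3! case=> //; do 28! (case; [lia|]); lia.
Qed.

(** * Growth estimates under the hypothesis on [n] *)

Section Growth.

Variables n K : nat.
Hypothesis K_ge3 : 3 <= K.
Hypothesis nK : 32 * K ^ (2 * K) <= 2 ^ (n + K).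

Lemma n_large : K + 5 <= n.
Proof.
have: 2 ^ (2 * K + 5) <= 2 ^ (n + K).
  apply: leq_trans nK; rewrite expnD mulnC leq_mul2l /= !expnM.
  by apply: leq_expl; rewrite -!mulnn; nia.
by rewrite leq_exp2l //; lia.
Qed.

(** With [d = K - l - s] the exponent of two drops by [2 * s + 1 + d]; this is paid by [32 = 4 * 8]
    and by the factor [K ^ (2 * (s - 1 + d))] removed on the left. *)
Lemma shifted_growth l s N : 0 < s -> l + s <= K -> n = N + s.+1 ->
  4 * K ^ 2 * K ^ (2 * l) <= 2 ^ (N + l).
Proof.
move=> s_gt0 lsK nE; have [d KE] : exists d, K = l + s.-1.+1 + d.
  by exists (K - (l + s)); lia.
have p_gt0 : 0 < 2 ^ (2 * s + 1 + d) by rewrite expn_gt0.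
rewrite -(leq_pmul2r p_gt0) -[leqRHS]expnD.
have -> : N + l + (2 * s + 1 + d) = n + K by lia.
apply: leq_trans nK.
have -> : K ^ (2 * K) = K ^ (2 * l) * (K ^ 2 * K ^ (2 * s.-1)) * K ^ (2 * d).
  by rewrite -!expnD; congr (K ^ _); lia.
have -> : 2 ^ (2 * s + 1 + d) = 2 ^ (2 * s) * 2 * 2 ^ d by rewrite !expnD.
have h1 : 4 ^ s.-1 <= K ^ (2 * s.-1) by rewrite expnM; apply: leq_expl; rewrite -mulnn; nia.
have h2 : 2 ^ d <= K ^ (2 * d) by rewrite expnM; apply: leq_expl; rewrite -mulnn; nia.
have -> : 2 ^ (2 * s) = 4 * 4 ^ s.-1 by rewrite -expnS prednK // expnM.
have h := leq_mul h1 h2.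
move: (K ^ 2) (K ^ (2 * l)) (K ^ (2 * s.-1)) (K ^ (2 * d)) (4 ^ s.-1) (2 ^ d) h.
move=> a b c e u w h.
have -> : 4 * a * b * (4 * u * 2 * w) = 32 * (a * b) * (u * w) by lia.
have -> : 32 * (b * (a * c) * e) = 32 * (a * b) * (c * e) by lia.
by rewrite leq_mul2l h orbT.
Qed.

(** Both sides are raised to the power [4 * l]. Since [c <= (7/3) * K ^ 2], the previous estimates
    give [c ^ (4 * l) <= 32 ^ N], and [exp_growth] supplies the factor [32 ^ N]. *)
Lemma ratio_growth m s N : 0 < m -> 0 < s -> m.+1 + s <= K -> n = N + s.+1 ->
  (2 * K ^ 2 + m.+1) * m ^ N <= m.+1 ^ N.
Proof.
move=> m_gt0 s_gt0 msK nE; set l := m.+1; set c := 2 * K ^ 2 + l.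
have hs := @shifted_growth l s N s_gt0 msK nE.
have hc : 32 * c ^ 4 <= 949 * K ^ 8.
  have: 3 * c <= 7 * K ^ 2 by rewrite /c /l -mulnn; nia.
  move/(leq_expl 4); rewrite (expnMn 3) (expnMn 7) -expnM.
  by move: (c ^ 4) (K ^ (2 * 4)) => x y; lia.
have c32 : c ^ (4 * l) <= 32 ^ N.
  have p_gt0 : 0 < 32 ^ l by rewrite expn_gt0.
  rewrite -(leq_pmul2l p_gt0) expnM -expnMn.
  apply: leq_trans (leq_expl l hc) _; rewrite expnMn -expnM.
  have lK : l <= K by lia.
  apply: leq_trans (leq_mul (finite_growth_check K_ge3 lK) (leqnn _)) _.
  have := leq_expl 5 hs; rewrite (expnMn _ (K ^ (2 * l))) (expnMn 4) -!expnM.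
  have -> : 32 ^ l * 32 ^ N = 2 ^ ((N + l) * 5) by rewrite -expnD mulnC expnM addnC.
  move/(leq_trans _); apply.
  have e1 : K ^ (2 * l) * K ^ (8 * l) = K ^ (2 * l * 5).
    by rewrite -expnD; congr (K ^ _); lia.
  by rewrite -(mulnA _ (K ^ (2 * l))) e1 (_ : 4 ^ 5 = 1024) // (_ : 2 * 5 = 10).
have e_gt0 : 0 < 4 * l by [].
rewrite -(leq_exp2r _ _ e_gt0) expnMn -!expnM ![N * _]mulnC.
apply: leq_trans (exp_growth m N); exact: leq_mul.
Qed.

Lemma s2_ratio_growth k s : 0 < s -> s + 2 <= k <= K ->
  2 * K ^ 2 * s2 (n - s - 1) (k - s - 1) <= s2 (n - s) (k - s).
Proof.
move=> s_gt0 /andP[sk kK]; have nl := n_large.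
have [N nE] : exists N, n = N + s.+1 by exists (n - s.+1); lia.
have [m mE] : exists m, k - s = m.+1 by exists (k - s).-1; lia.
have -> : n - s - 1 = N by lia.
have -> : n - s = N.+1 by lia.
rewrite mE subn1 /=; apply: s2_step; apply: ratio_growth nE; lia.
Qed.

(** Above [k - 2] singletons there are [S(n - k + 2, 2) = 2 ^ (n - k + 1) - 1] partitions; this
    bound leaves room there for two factors [2 * K ^ 2]. *)
Lemma two_pow_large k : k <= K -> (2 * K ^ 2) ^ 2 < 2 ^ (n - k).+1.
Proof.
move=> kK; have nl := n_large.
apply: (@leq_trans (2 ^ (n - K).+1)); last by rewrite leq_exp2l //; lia.
have p_gt0 : 0 < 4 ^ K by rewrite expn_gt0.
rewrite -(ltn_pmul2r p_gt0).
have -> : 2 ^ (n - K).+1 * 4 ^ K = 2 * 2 ^ (n + K).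
  by rewrite -[4]/(2 ^ 2) -expnM -expnD -expnS; congr (2 ^ _); lia.
apply: (@leq_trans (64 * K ^ (2 * K))); last by lia.
rewrite (expnMn 2) -expnM; case: (ltngtP K 3) K_ge3 => // [K4|-> //] _.
have [d KE] : exists d, K = 4 + d by exists (K - 4); lia.
have -> : K ^ (2 * K) = K ^ 4 * K ^ 4 * (K ^ 2) ^ d.
  by rewrite -expnM -!expnD; congr (K ^ _); lia.
have -> : 4 ^ K = 256 * 4 ^ d by rewrite {1}KE expnD.
have h : 4 ^ d <= (K ^ 2) ^ d by apply: leq_expl; rewrite -mulnn; nia.
have h' : 256 <= K ^ 4 by rewrite (_ : 256 = 4 ^ 4) //; apply: leq_expl.
have hp : 0 < (K ^ 2) ^ d by rewrite !expn_gt0; lia.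
rewrite (_ : 2 ^ 2 = 4) // (_ : 2 * 2 = 4) //.
move: (K ^ 4) ((K ^ 2) ^ d) (4 ^ d) h h' hp => a b e h h' hp.
apply: (@leq_ltn_trans (4 * a * (256 * b))); first by rewrite leq_mul // leq_mul.
nia.
Qed.

(** Two facts are combined: [4 * K ^ 4 * 4 ^ N <= (3 ^ N) ^ 2], from [ratio_growth] at [m = 2], and
    [(3 ^ N) ^ 5 <= (4 ^ N) ^ 4], from [243 <= 256]. *)
Lemma four_thirds_growth t N : 0 < t -> t + 3 <= K -> n = N + t.+1 -> 2 * K * 3 ^ N <= 4 ^ N.
Proof.
move=> t_gt0 tK nE; have := @ratio_growth 2 t N isT t_gt0.
rewrite addnC => /(_ tK nE) h1.
have h2 : (3 ^ N) ^ 5 <= (4 ^ N) ^ 4.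
  by rewrite -!expnM ![N * _]mulnC !expnM; apply: leq_expl.
have h3 : 4 ^ N = 2 ^ N * 2 ^ N by rewrite -expnMn.
have c_gt0 : 0 < 2 ^ N by rewrite expn_gt0.
move: h1 h2 h3 c_gt0; move: (3 ^ N) (4 ^ N) (2 ^ N) => b a c h1 h2 h3 c_gt0.
have h4 : 4 * K ^ 4 * a <= b ^ 2.
  have : 2 * K ^ 2 * c <= b by apply: leq_trans h1; rewrite leq_mul2r leq_addr orbT.
  by move/(leq_expl 2); rewrite (expnMn _ c) (expnMn 2) -expnM h3 mulnn.
have a_gt0 : 0 < a by rewrite h3 muln_gt0 c_gt0.
rewrite -(@leq_exp2r _ _ 3) // -(leq_pmul2r a_gt0) -expnSr.
apply: leq_trans h2; rewrite (expnD b 3 2).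
apply: leq_trans (leq_mul (leqnn _) h4).
rewrite !expnMn (expnS K 3) /=.
have : 2 * K ^ 3 <= K * K ^ 3 by rewrite leq_mul2r; lia.
move: (K ^ 3) (b ^ 3) => u w h.
have -> : 2 ^ 3 * u * w * a = 4 * (2 * u) * (w * a) by lia.
have -> : w * (4 * (K * u) * a) = 4 * (K * u) * (w * a) by lia.
by rewrite leq_mul2r leq_mul2l h !orbT.
Qed.

(** By [s2_ratio_le] the ratio of [S(n - t, k - t)] to [S(n - t - 1, k - t - 1)] is largest at
    [k - t = 3], where powers of 3 and 4 are compared. *)
Lemma s2_large_small t k : 0 < t -> t + 3 <= k <= K ->
  K * s2 (n - t) (k - t) <= s2 (n - t) 2 * s2 (n - t - 1) (k - t - 1).
Proof.
move=> t_gt0 /andP[tk kK]; have nl := n_large.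
have [N nE] : exists N, n = N + t.+1 by exists (n - t.+1); lia.
have [m mE] : exists m, k - t = m.+3 by exists (k - t - 3); lia.
have -> : n - t - 1 = N by lia.
have -> : n - t = N.+1 by lia.
rewrite mE subn1 /= s2_2.
have h3 : K * s2 N.+1 3 <= (2 ^ N - 1) * s2 N 2.
  have h := four_thirds_growth t_gt0 (leq_trans tk kK) nE.
  have N4 : 4 <= N by lia.
  have u := surj_le N.+1 3; rewrite /surj expnS in u.
  have [M NE] : exists M, N = M.+1 by exists N.-1; lia.
  have w : 4 <= 2 ^ N by rewrite (_ : 4 = 2 ^ 2) // leq_exp2l //; lia.
  have w' : 16 <= 2 ^ N by rewrite (_ : 16 = 2 ^ 4) // leq_exp2l //; lia.
  have e4 : 4 ^ N = 2 ^ N * 2 ^ N by rewrite -expnMn.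
  have -> : s2 N 2 = 2 ^ M - 1 by rewrite NE s2_2.
  have e : 2 ^ N = 2 * 2 ^ M by rewrite NE expnS.
  rewrite -(@leq_pmul2l 2) //.
  apply: (@leq_trans (K * 3 ^ N)).
    rewrite mulnCA leq_mul2l; apply/orP; right; rewrite (_ : 3`! = 6) // in u; lia.
  rewrite mulnCA mulnBr -e muln1; move: h e4 w'; move: (3 ^ N) (4 ^ N) (2 ^ N) => b a c; nia.
have p_gt0 : 0 < s2 N 2 by apply: s2_gt0; lia.
rewrite -(leq_pmul2r p_gt0) -mulnA.
have := @s2_ratio_le N 2 m.+2 isT => r.
apply: leq_trans (leq_mul (leqnn K) r) _.
rewrite mulnA [leqRHS]mulnAC; exact: leq_mul.
Qed.

(** After cubing, the hypothesis on [e] reduces the claim to [32 * (t + 1) ^ 3 <= 2 ^ (n - t)]. Here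
    [e] will be the total size of two blocks, neither larger than a third one. *)
Lemma two_pow_pairs t e : t + 2 <= K -> 3 * e <= 2 * (n - t + 1) ->
  2 * (t + 1) * 2 ^ e <= 2 ^ (n - t).
Proof.
move=> tK he; have nl := n_large.
have big : 32 * (t + 1) ^ 3 <= 2 ^ (n - t).
  have p_gt0 : 0 < 4 ^ K by rewrite expn_gt0.
  rewrite -(leq_pmul2r p_gt0).
  have h : 4 * 2 ^ (n + K) <= 2 ^ (n - t) * 4 ^ K.
    by rewrite -[4 ^ K]/((2 ^ 2) ^ K) -[4]/(2 ^ 2) -expnM -!expnD leq_exp2l //; lia.
  apply: leq_trans h; apply: (@leq_trans (128 * K ^ (2 * K))); last by lia.
  have [d KE] : exists d, K = 3 + d by exists (K - 3); lia.
  have -> : K ^ (2 * K) = K ^ 3 * K ^ 3 * (K ^ 2) ^ d.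
    by rewrite -expnM -!expnD; congr (K ^ _); lia.
  have -> : 4 ^ K = 64 * 4 ^ d by rewrite {1}KE expnD.
  have h : 4 ^ d <= (K ^ 2) ^ d by apply: leq_expl; rewrite -mulnn; nia.
  have h1 : (t + 1) ^ 3 <= K ^ 3 by apply: leq_expl; lia.
  have h2 : 27 <= K ^ 3 by rewrite (_ : 27 = 3 ^ 3) //; apply: leq_expl.
  rewrite mulnA [leqRHS]mulnA; apply: leq_mul h.
  move: ((t + 1) ^ 3) (K ^ 3) h1 h2 => a b; nia.
rewrite -(@leq_exp2r _ _ 3) // !expnMn -!expnM.
have h1 : 2 ^ (e * 3) <= 2 ^ (2 * (n - t + 1)) by rewrite leq_exp2l //; lia.
apply: leq_trans (leq_mul (leqnn _) h1) _.
rewrite (_ : (n - t) * 3 = (n - t) + 2 * (n - t)); last by lia.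
rewrite mulnDr !expnD (_ : 2 ^ 3 = 8) // (_ : 2 ^ (2 * 1) = 4) //.
move: big; move: ((t + 1) ^ 3) (2 ^ (n - t)) (2 ^ (2 * (n - t))) => a b c; nia.
Qed.

End Growth.

(** * Covers and branching *)

Lemma leq_card_bigcup (T1 T2 : finType) (Y : {set T1}) (E : T1 -> {set T2}) :
  #|\bigcup_(e in Y) E e| <= \sum_(e in Y) #|E e|.
Proof.
elim/big_rec2: _ => [|e n A _ IH]; first by rewrite cards0.
by rewrite (leq_trans (leq_card_setU _ _)) // leq_add2l.
Qed.

Lemma subset_with_card (T : finType) (A : {set T}) m :
  m <= #|A| -> exists2 Y : {set T}, Y \subset A & #|Y| = m.
Proof.
move=> le_m; have: 0 < #|[set Y : {set T} | Y \subset A & #|Y| == m]|.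
  by rewrite cards_draws bin_gt0.
by case/card_gt0P=> Y; rewrite inE => /andP[sYA /eqP cY]; exists Y.
Qed.

Lemma bin_leq_exp s x : 'C(s + x, s) <= s.+1 ^ x.
Proof.
elim: x => [|x IHx]; first by rewrite addn0 binn.
suff: 'C(s + x.+1, s) <= s.+1 * 'C(s + x, s).
  by move=> /leq_trans; apply; rewrite expnS leq_mul2l IHx orbT.
have E : 'C(s + x.+1, x.+1) = 'C(s + x.+1, s).
  by rewrite -[RHS]bin_sub ?leq_addr // addKn.
have E' : 'C(s + x, x) = 'C(s + x, s) by rewrite -[RHS]bin_sub ?leq_addr // addKn.
have := mul_bin_diag (s + x.+1) x; rewrite E addnS /= E' => H.
rewrite -(leq_pmul2l (ltn0Sn x)) -H mulnA leq_mul2r; apply/orP; right; nia.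
Qed.

Lemma card_setI_lt (T : finType) (A X : {set T}) : ~~ (A \subset X) -> #|A :&: X| < #|A|.
Proof.
move=> nAX; rewrite proper_card // properE subsetIl /=.
by apply: contra nAX => /subset_trans; apply; rewrite subsetIr.
Qed.

Lemma card_setD1_eq (T : finType) (A : {set T}) c m : #|A| = m.+1 -> c \in A -> #|A :\ c| = m.
Proof. by move=> cA cinA; have := cardsD1 c A; rewrite cinA cA add1n => -[]. Qed.

Lemma setD1_sub_of_card (T : finType) (A G : {set T}) c m :
  #|A| = m.+1 -> c \in A -> c \notin G -> m <= #|A :&: G| -> A :\ c \subset G.
Proof.
move=> cA cinA cG le; have /eqP <- : A :&: G == A :\ c; last by rewrite subsetIr.
rewrite eqEcard (card_setD1_eq cA cinA) le andbT.
apply/subsetP => e; rewrite !inE => /andP[eA eG].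
by rewrite eA andbT; apply: contraNneq cG => <-.
Qed.

Section Branching.

Variables (B Om : finType) (GG : {set Om}) (phi : Om -> {set B}).
Implicit Types A X T : {set B}.

Lemma branch_step s D A X m :
    (forall g, g \in GG -> s <= #|phi g :&: X|) -> #|X| < D + s -> #|A :&: X| < s ->
    (forall e, e \notin A -> #|[set g in GG | e |: A \subset phi g]| <= m) ->
  #|[set g in GG | A \subset phi g]| <= D * m.
Proof.
move=> HX cX AX Hm.
(* Removing [Y] leaves fewer than [s] blocks of [X], so every [phi g] meets [Y]. There is room for
   [Y] outside [A] because [A] shares fewer than [s] blocks with [X]. *)
have [|Y sY cY] := @subset_with_card _ (X :\: A) (#|X|.+1 - s).
  by rewrite cardsD setIC; lia.
have sub : [set g in GG | A \subset phi g] \subset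
    \bigcup_(e in Y) [set g in GG | e |: A \subset phi g].
  apply/subsetP => g; rewrite inE => /andP[gG sA].
  have: ~~ [disjoint Y & phi g].
    apply/negP => dis; have := HX g gG.
    have sYX : Y \subset X by apply: subset_trans sY (subsetDl _ _).
    have: #|phi g :&: X| <= #|X :\: Y|.
      apply/subset_leq_card/subsetP => e; rewrite !inE => /andP[eg ->].
      by rewrite (disjointFl dis eg).
    rewrite cardsD (setIidPr sYX) cY.
    have := subset_leq_card sYX; rewrite cY; lia.
  case/pred0Pn => e /= /andP[eY eg]; apply/bigcupP; exists e => //.
  by rewrite inE gG subUset sub1set eg sA.
apply: leq_trans (subset_leq_card sub) _; apply: leq_trans (leq_card_bigcup _ _) _.
apply: (@leq_trans (\sum_(e in Y) m)).
  apply: leq_sum => e eY; apply: Hm.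
  by move/subsetP: sY => /(_ e eY); rewrite inE => /andP[].
by rewrite sum_nat_const cY leq_mul2r; apply/orP; right; lia.
Qed.

Variable V : nat -> nat.
Hypothesis HV : forall A, #|[set g in GG | A \subset phi g]| <= V #|A|.

Lemma branch s D j A :
    (forall A', A \subset A' -> #|A'| < #|A| + j ->
      exists X, [/\ forall g, g \in GG -> s <= #|phi g :&: X|, #|X| < D + s
                  & #|A' :&: X| < s]) ->
  #|[set g in GG | A \subset phi g]| <= D ^ j * V (#|A| + j).
Proof.
elim: j A => [|j IHj] A H; first by rewrite expn0 mul1n addn0.
have [|X [HX cX AX]] := H A (subxx _); first by rewrite addnS ltnS leq_addr.
rewrite expnS -mulnA; apply: branch_step HX cX AX _ => e eA.
have cE : #|e |: A| = #|A|.+1 by rewrite cardsU1 eA.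
rewrite addnS -addSn -cE; apply: IHj => A' sA' cA'; apply: H.
  by apply: subset_trans sA'; rewrite subsetUr.
by rewrite addnS -addSn -cE.
Qed.

Lemma branch_from_cover s T m :
    (forall g, g \in GG -> s <= #|T :&: phi g|) ->
    (forall A, A \subset T -> #|A| = s -> #|[set g in GG | A \subset phi g]| <= m) ->
  #|GG| <= 'C(#|T|, s) * m.
Proof.
move=> HT Hm; rewrite -cards_draws.
set DD := [set _ | _ & _].
have sub : GG \subset \bigcup_(A in DD) [set g in GG | A \subset phi g].
  apply/subsetP => g gG; have [Y sY cY] := subset_with_card (HT g gG).
  apply/bigcupP; exists Y; last first.
    by rewrite inE gG (subset_trans sY) // subsetIr.
  by rewrite inE cY eqxx (subset_trans sY) // subsetIl.
apply: leq_trans (subset_leq_card sub) _; apply: leq_trans (leq_card_bigcup _ _) _.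
rewrite -sum_nat_const; apply: leq_sum => A.
by rewrite inE => /andP[sA /eqP cA]; apply: Hm.
Qed.

End Branching.

(** * Selections of one member from each family, and the two-sided bound *)

Section Selections.

Variables (B I : finType) (F : I -> {set {set B}}).
Implicit Types (E : I -> {set {set B}}) (J : {set I}) (A T X : {set B}) (f g : {ffun I -> {set B}}).

(* The padding by [set0] outside [J] makes the number of selections exactly the product over [J]. *)
Definition sel (E : I -> {set {set B}}) J : {set {ffun I -> {set B}}} :=
  [set f in family (fun i => if i \in J then E i else [set set0])].

Definition inter J f : {set B} := \bigcap_(i in J) f i.

Definition cross J s := forall f, f \in sel F J -> s <= #|inter J f|.

Definition cov J s T := [forall f in sel F J, s <= #|T :&: inter J f|].

Lemma covP J s T :
  reflect (forall f, f \in sel F J -> s <= #|T :&: inter J f|) (cov J s T).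
Proof. exact: forall_inP. Qed.

Lemma selP E J f :
  reflect ((forall i, i \in J -> f i \in E i) /\ (forall i, i \notin J -> f i = set0))
          (f \in sel E J).
Proof.
rewrite inE; apply: (iffP familyP) => [H|[H1 H2] i].
  split=> i iJ; have := H i; rewrite ?iJ ?(negbTE iJ) //.
  by rewrite inE => /eqP.
by case: ifPn => [/H1|/H2->] //; rewrite inE.
Qed.

Lemma card_sel E J : #|sel E J| = \prod_(i in J) #|E i|.
Proof.
rewrite cardsE card_family foldrE big_map big_enum /= [RHS]big_mkcond /=.
by apply: eq_bigr => i _; case: ifP => // _; rewrite cards1.
Qed.

Lemma subset_inter J f A : (A \subset inter J f) = [forall i in J, A \subset f i].
Proof. by apply/bigcapsP/forall_inP. Qed.

Lemma inter_sub J f i : i \in J -> inter J f \subset f i.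
Proof. by move=> iJ; apply: bigcap_inf. Qed.

Lemma inter_merge J1 J2 f g : [disjoint J1 & J2] -> f \in sel F J1 -> g \in sel F J2 ->
  exists2 h, h \in sel F (J1 :|: J2) & inter (J1 :|: J2) h = inter J1 f :&: inter J2 g.
Proof.
move=> dis /selP[f1 f2] /selP[g1 g2].
exists [ffun i => if i \in J1 then f i else g i].
  apply/selP; split=> i; rewrite inE ffunE.
    by case: ifP => [/f1 //|_ /= /g1].
  by rewrite negb_or => /andP[/negbTE-> /g2].
have E1 i : i \in J1 -> [ffun i => if i \in J1 then f i else g i] i = f i.
  by move=> iJ; rewrite ffunE iJ.
have E2 i : i \in J2 -> [ffun i => if i \in J1 then f i else g i] i = g i.
  by move=> iJ; rewrite ffunE (disjointFl dis iJ).
apply/setP => e; rewrite inE; apply/bigcapP/andP => [H|[/bigcapP H1 /bigcapP H2] i].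
  by split; apply/bigcapP => i iJ; have := H i; rewrite inE iJ ?orbT ?(E1 _ iJ) ?(E2 _ iJ); apply.
by rewrite inE => /orP[] iJ; rewrite ?(E1 _ iJ) ?(E2 _ iJ); auto.
Qed.

Lemma sel1P i f : reflect (exists2 G, G \in F i & f = [ffun j => if j == i then G else set0])
                          (f \in sel F [set i]).
Proof.
apply: (iffP (selP _ _ _)) => [[H1 H2]|[G GF ->]].
  exists (f i); first by apply: H1; rewrite inE.
  apply/ffunP => j; rewrite ffunE; case: eqP => [->//|/eqP ji].
  by apply: H2; rewrite inE.
split=> j; rewrite inE ffunE => ji; last by rewrite (negbTE ji).
by rewrite ji (eqP ji).
Qed.

Lemma inter1 i f : inter [set i] f = f i.
Proof. by rewrite /inter big_set1. Qed.

Lemma cov1P i s T : reflect (forall G, G \in F i -> s <= #|T :&: G|) (cov [set i] s T).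
Proof.
apply: (iffP (covP _ _ _)) => H f.
  move=> fF; have /H : [ffun j => if j == i then f else set0] \in sel F [set i].
    by apply/sel1P; exists f.
  by rewrite inter1 ffunE eqxx.
by case/sel1P => G GF ->; rewrite inter1 ffunE eqxx; apply: H.
Qed.

Lemma card_sel_above v J A :
    (forall i A, #|[set G in F i | A \subset G]| <= v i #|A|) ->
  #|[set f in sel F J | A \subset inter J f]| <= \prod_(i in J) v i #|A|.
Proof.
move=> Hv; pose E i := [set G in F i | A \subset G].
apply: (@leq_trans #|sel E J|); last by rewrite card_sel; apply: leq_prod => i _; apply: Hv.
apply/subset_leq_card/subsetP => f; rewrite inE subset_inter => /andP[/selP[f1 f2] /forall_inP H].
by apply/selP; split=> // i iJ; rewrite inE f1 ?H.
Qed.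

Section Nonempty.

Hypothesis F_ne : forall i, F i != set0.

Lemma sel_through J i G : i \in J -> G \in F i ->
  exists2 f, f \in sel F J & f i = G.
Proof.
move=> iJ GF; pose h j := if j == i then G else odflt set0 [pick X in F j].
exists [ffun j => if j \in J then h j else set0]; last by rewrite ffunE iJ /h eqxx.
apply/selP; split=> j jJ; rewrite ffunE ?jJ ?(negbTE jJ) // /h.
case: eqP => [->//|_]; case: pickP => [X //|H].
by have [X XF] := set0Pn _ (F_ne j); have := H X; rewrite /= XF.
Qed.

Lemma sel_through2 J i i' G G' : i \in J -> i' \in J -> i != i' -> G \in F i -> G' \in F i' ->
  exists f, [/\ f \in sel F J, f i = G & f i' = G'].
Proof.
move=> iJ iJ' ne GF GF'; have [f fs fi] := sel_through iJ GF.
exists [ffun j => if j == i' then G' else f j]; rewrite !ffunE eqxx (negbTE ne); split=> //.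
case/selP: fs => f1 f2; apply/selP; split=> j jJ; rewrite ffunE; case: eqP => [E|_]; auto.
  by rewrite E.
by rewrite E iJ' in jJ.
Qed.

Lemma sel_through3 J i1 i2 i3 G1 G2 G3 :
    [/\ i1 \in J, i2 \in J & i3 \in J] -> [/\ i1 != i2, i2 != i3 & i3 != i1] ->
    [/\ G1 \in F i1, G2 \in F i2 & G3 \in F i3] ->
  exists f, [/\ f \in sel F J, f i1 = G1, f i2 = G2 & f i3 = G3].
Proof.
move=> [J1 J2 J3] [n12 n23 n31] [F1 F2 F3].
have [f [fs f1 f2]] := sel_through2 J1 J2 n12 F1 F2.
exists [ffun j => if j == i3 then G3 else f j].
rewrite !ffunE eqxx (negbTE n23) eq_sym (negbTE n31); split=> //.
case/selP: fs => h1 h2; apply/selP; split=> j jJ; rewrite ffunE; case: eqP => [E|_]; auto.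
  by rewrite E.
by rewrite E J3 in jJ.
Qed.

Lemma sel_ne J : exists f, f \in sel F J.
Proof.
have: 0 < #|sel F J| by rewrite card_sel prodn_cond_gt0 // => i _; rewrite card_gt0.
by case/card_gt0P => f; exists f.
Qed.

(** A set with fewer than [s + z] blocks is no cover of the [J2] side, so some intersection over
    [J2] shares fewer than [s] blocks with it. All selections over [J1] share [s] blocks with that
    intersection, which permits a branching step. The number [j] of steps is left to the caller. *)
Lemma cross_bound v K1 K2 s J1 J2 :
    (forall i A, #|[set G in F i | A \subset G]| <= v i #|A|) ->
    [disjoint J1 & J2] -> cross (J1 :|: J2) s ->
    (forall f, f \in sel F J1 -> #|inter J1 f| < K1 + s) ->
    (forall f, f \in sel F J2 -> #|inter J2 f| < K2 + s) ->
  exists x z : nat,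
    [/\ (exists2 T : {set B}, #|T| = s + x & cov J1 s T) /\ (forall T, cov J1 s T -> s + x <= #|T|),
        (exists2 T : {set B}, #|T| = s + z & cov J2 s T) /\ (forall T, cov J2 s T -> s + z <= #|T|),
        (forall j, j <= z -> \prod_(i in J1) #|F i|
           <= 'C(s + x, s) * (K2 ^ j * \prod_(i in J1) v i (s + j)))
      & (forall j, j <= x -> \prod_(i in J2) #|F i|
           <= 'C(s + z, s) * (K1 ^ j * \prod_(i in J2) v i (s + j)))].
Proof.
move=> Hv dis cr bd1 bd2.
have HV J A := card_sel_above J A Hv.
have crI f g : f \in sel F J1 -> g \in sel F J2 -> s <= #|inter J1 f :&: inter J2 g|.
  by move=> fs gs; have [h hs <-] := inter_merge dis fs gs; apply: cr.
have mincov J T0 : cov J s T0 -> exists2 T, cov J s T & forall A, cov J s A -> #|T| <= #|A|.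
  by move=> c0; case: (@arg_minnP _ T0 (cov J s) (fun T => #|T|) c0) => T cT Tmin; exists T.
have covge J T : cov J s T -> s <= #|T|.
  have [f fs] := sel_ne J; move/covP => /(_ f fs) /leq_trans; apply.
  by rewrite subset_leq_card // subsetIl.
have [f1 f1s] := sel_ne J1; have [f2 f2s] := sel_ne J2.
have [|T1 cT1 T1min] := mincov J1 (inter J2 f2).
  by apply/covP => f fs; rewrite setIC; apply: crI.
have [|T2 cT2 T2min] := mincov J2 (inter J1 f1).
  by apply/covP => f fs; apply: crI.
have e1 := covge _ _ cT1; have e2 := covge _ _ cT2.
exists (#|T1| - s), (#|T2| - s); rewrite !subnKC //; split.
- by split; [exists T1|].
- by split; [exists T2|].
- move=> j jz; rewrite -card_sel.
  apply: (branch_from_cover (phi := inter J1)) => [f fs|A sA cA].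
    by move/covP: cT1; apply.
  rewrite -cA; apply: (@branch _ _ _ _ (fun a => \prod_(i in J1) v i a) (HV J1) s) => A' sA' cA'.
  have: ~~ cov J2 s A' by apply: contraTN cA' => /T2min; lia.
  rewrite negb_forall_in => /exists_inP[g gs]; rewrite -ltnNge => lt.
  by exists (inter J2 g); split=> //; [move=> f fs; apply: crI | apply: bd2].
- move=> j jz; rewrite -card_sel.
  apply: (branch_from_cover (phi := inter J2)) => [f fs|A sA cA].
    by move/covP: cT2; apply.
  rewrite -cA; apply: (@branch _ _ _ _ (fun a => \prod_(i in J2) v i a) (HV J2) s) => A' sA' cA'.
  have: ~~ cov J1 s A' by apply: contraTN cA' => /T1min; lia.
  rewrite negb_forall_in => /exists_inP[g gs]; rewrite -ltnNge => lt.
  exists (inter J1 g); split=> //; last exact: bd1.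
  by move=> f fs; rewrite setIC; apply: crI.
Qed.

End Nonempty.
End Selections.

(** * Bound for abstract cross-intersecting families *)

Lemma prod_setC1 (I : finType) (a : I) (g : I -> nat) :
  \prod_i g i = g a * \prod_(i in [set~ a]) g i.
Proof. by rewrite (bigD1 a) //=; congr (_ * _); apply: eq_bigl => i; rewrite !inE. Qed.

(** Here [a1], [a2] are binomial losses, [b1], [b2] branching losses, and [d1], [d2] the gains from
    decaying weights. *)
Lemma leq_mul_decay (N1 N2 a1 a2 b1 b2 w1 w2 W1 W2 d1 d2 : nat) :
    N1 <= a1 * (b1 * w1) -> N2 <= a2 * (b2 * w2) ->
    d1 * w1 <= W1 -> d2 * w2 <= W2 ->
    (a1 * b1) * (a2 * b2) <= d1 * d2 -> 0 < d1 * d2 ->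
  N1 * N2 <= W1 * W2.
Proof.
move=> h1 h2 g1 g2 ab d_gt0; rewrite -(leq_pmul2l d_gt0).
apply: leq_trans (leq_mul (leqnn _) (leq_mul h1 h2)) _.
have -> : d1 * d2 * (a1 * (b1 * w1) * (a2 * (b2 * w2))) =
  a1 * b1 * (a2 * b2) * (d1 * w1 * (d2 * w2)) by lia.
by apply: leq_mul ab _; apply: leq_mul.
Qed.

(* [small i] stands for [k i = t + 2] and [v i s] bounds the number of members of [F i] containing
   [s] given blocks. *)
Section AbstractBound.

Variables (B I : finType) (F : I -> {set {set B}}) (v : I -> nat -> nat).
Variables (small : pred I) (t K q : nat).
Implicit Types (J : {set I}) (A T X G H P : {set B}) (f : {ffun I -> {set B}}).

Hypothesis t_gt0 : 0 < t.
Hypothesis I_gt2 : 2 < #|I|.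
Hypothesis leK : t + 2 <= K.
Hypothesis leq_q : 2 * K ^ 2 <= q.
Hypothesis Hv : forall i A, #|[set G in F i | A \subset G]| <= v i #|A|.
Hypothesis v_gt0 : forall i, 0 < v i t.+1.
Hypothesis v_geo : forall i z, q ^ z * v i (t + z) <= v i t.
Hypothesis v_geo_large : forall i x, ~~ small i -> q ^ x * v i (t.+1 + x) <= v i t.+1.
Hypothesis v_large_small : forall a b, ~~ small a -> small b ->
  K * v a t <= v b t * v a t.+1.
Hypothesis v_small : forall i, small i -> v i t.+1 = 1.
Hypothesis card_le : forall i G, G \in F i -> #|G| <= K.
Hypothesis card_small : forall i G, small i -> G \in F i -> #|G| = t + 2.
Hypothesis near_small : forall b P i, small b -> P \in F b ->
  #|[set G in F i | t.+1 <= #|G :&: P|]| <= v i t.+1.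

(** For exact weights this is [(t + 1) * S(n-t, k-t) - t * S(n-t-1, k-t-1)], the number of
    partitions containing at least [t] of [t + 1] given singletons. *)
Definition extremal_count i := v i t + t * (v i t - v i t.+1).

Hypothesis near_small2 : forall a b P, small a -> small b -> P \in F b ->
  #|[set H in F a | t <= #|H :&: P|]| < extremal_count a \/
  exists2 T : {set B}, #|T| = t.+1 &
    forall H, H \in F a -> t <= #|H :&: P| -> t <= #|T :&: H|.
Hypothesis F_ne : forall i, F i != set0.
Hypothesis crossF : cross F [set: I] t.
Hypothesis nontrivF : forall A, #|A| = t -> exists i, exists2 G, G \in F i & ~~ (A \subset G).

Local Lemma K_ge3 : 3 <= K. Proof. lia. Qed.
Local Lemma q_gt : K.+1 < q. Proof. have := K_ge3; nia. Qed.
Local Lemma q_gt0 : 0 < q. Proof. exact: leq_ltn_trans q_gt. Qed.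
Local Lemma v_step i : q * v i t.+1 <= v i t.
Proof. by have := v_geo i 1; rewrite expn1 addn1. Qed.

Local Lemma extremal_gt i : v i t < extremal_count i.
Proof. rewrite /extremal_count; have := v_step i; have := v_gt0 i; have := q_gt; nia. Qed.

Local Lemma card_inter_le J f : f \in sel F J -> 0 < #|J| -> #|inter J f| <= K.
Proof.
case/selP => f1 _ /card_gt0P[i iJ].
by apply: leq_trans (card_le (f1 i iJ)); rewrite subset_leq_card ?inter_sub.
Qed.

Local Lemma card_inter2 J s i j G H : cross F J s -> i \in J -> j \in J -> i != j ->
  G \in F i -> H \in F j -> s <= #|G :&: H|.
Proof.
move=> cr iJ jJ ne GF HF; have [f [fs fi fj]] := sel_through2 F_ne iJ jJ ne GF HF.
apply: leq_trans (cr f fs) _; apply: subset_leq_card.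
by rewrite subsetI -fi -fj !inter_sub.
Qed.

Local Lemma card_full A i : (forall G, G \in F i -> A \subset G) -> #|F i| <= v i #|A|.
Proof.
move=> H; apply: leq_trans (Hv i A); apply/subset_leq_card/subsetP => G GF.
by rewrite inE GF H.
Qed.

Local Lemma geo_prod J x c : (forall i, i \in J -> ~~ small i) -> c <= #|J| ->
  q ^ (x * c) * \prod_(i in J) v i (t.+1 + x) <= \prod_(i in J) v i t.+1.
Proof.
move=> lJ cJ; apply: (@leq_trans (\prod_(i in J) (q ^ x * v i (t.+1 + x)))).
  rewrite big_split /= prod_nat_const -expnM leq_mul2r leq_pexp2l ?q_gt0 ?orbT //.
  by rewrite leq_mul2l cJ orbT.
by apply: leq_prod => i iJ; apply: v_geo_large; apply: lJ.
Qed.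

Local Lemma exp_le_q x : (2 * (K * K)) ^ x <= q ^ x.
Proof. by apply: leq_expl; rewrite mulnn. Qed.

Local Lemma exp_le_q1 x : (K * K) ^ x <= q ^ x.
Proof. by apply: leq_trans (exp_le_q x); apply: leq_expl; rewrite leq_pmull. Qed.

Local Lemma bin_le s x : s.+1 <= K -> 'C(s + x, s) <= K ^ x.
Proof. by move=> sK; apply: leq_trans (bin_leq_exp s x) _; apply: leq_expl. Qed.

Local Lemma disjoint1D1 (b : I) J : [disjoint [set b] & J :\ b].
Proof. by rewrite disjoints1 !inE eqxx. Qed.

(** Next to a small family [b], [near_small] bounds all other families at once, so only an oversized
    [F b] needs work, and then all other families are large. Without small families the decay on
    both sides pays for the full branching. *)
Lemma cross_succ_bound J : 1 < #|J| -> cross F J t.+1 ->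
  \prod_(i in J) #|F i| <= \prod_(i in J) v i t.+1.
Proof.
move=> J_gt1 crJ.
have nearb b i : b \in J -> small b -> i \in J -> i != b -> #|F i| <= v i t.+1.
  move=> bJ sb iJ ib; have [P PF] := set0Pn _ (F_ne b).
  apply: leq_trans (near_small i sb PF); apply/subset_leq_card/subsetP => G GF.
  by rewrite inE GF (card_inter2 crJ iJ bJ).
have split_b b : b \in J -> forall g, \prod_(i in J) g i = g b * \prod_(i in J :\ b) g i.
  by move=> bJ g; rewrite (big_setD1 b bJ).
have bd K' (b : I) : #|J :\ b| > 0 -> K <= K' -> forall f, f \in sel F (J :\ b) ->
    #|inter (J :\ b) f| < K' + t.+1.
  by move=> Jb KK' f fs; have := card_inter_le fs Jb; lia.
have Jb_gt0 b : b \in J -> 0 < #|J :\ b|.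
  by move=> bJ; rewrite (cardsD1 b) bJ in J_gt1; lia.
case: (pickP (fun b => (b \in J) && small b)) => [b /andP[bJ sb]|nosmall].
  case: (leqP #|F b| (v b t.+1)) => [Fb|Fb].
    apply: leq_prod => i iJ; have [->//|ib] := eqVneq i b; exact: nearb bJ sb iJ ib.
  have large i : i \in J :\ b -> ~~ small i.
    rewrite !inE => /andP[ib iJ]; apply/negP => si.
    by have := nearb i b iJ si bJ; rewrite eq_sym ib leqNgt Fb => /(_ isT).
  have crJ' : cross F ([set b] :|: (J :\ b)) t.+1 by rewrite setD1K.
  (* Members of [F b] have [t + 2] blocks, so branching on them costs 2 instead of [K]. *)
  have bd1 f : f \in sel F [set b] -> #|inter [set b] f| < 2 + t.+1.
    by case/sel1P => G GF ->; rewrite inter1 ffunE eqxx (card_small sb GF); lia.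
  have [x [z [[_ _] [_ zmin] N1 N2]]] :=
    cross_bound F_ne Hv (disjoint1D1 b J) crJ' bd1 (bd K b (Jb_gt0 b bJ) (leqnn K)).
  have z_le1 : z <= 1.
    have [P PF] := set0Pn _ (F_ne b).
    suff /zmin : cov F (J :\ b) t.+1 P by rewrite (card_small sb PF); lia.
    apply/covP => f fs.
    have Ps : [ffun j => if j == b then P else set0] \in sel F [set b].
      by apply/sel1P; exists P.
    have [h hs hE] := inter_merge (disjoint1D1 b J) Ps fs.
    by have := crJ' h hs; rewrite hE inter1 ffunE eqxx.
  (* For [x = 0] the family [F b] would not be oversized. With [z <= 1 <= x] the total loss
     [K ^ x * K ^ z * 2 ^ x] is at most [(2 * K ^ 2) ^ x], which the large families regain. *)
  have x_gt0 : 0 < x.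
    case: x N1 {N2} => // N1; have := N1 0 (leq0n _).
    by rewrite !big_set1 !addn0 binn !mul1n leqNgt Fb.
  rewrite !(split_b b bJ).
  have := N1 0 (leq0n _); rewrite !big_set1 expn0 addn0 => N1'.
  apply: (leq_mul_decay N1' (N2 x (leqnn x)) (d1 := 1) (d2 := q ^ x)); rewrite ?mul1n ?muln1 //.
  - by rewrite -[x in q ^ x]muln1; apply: geo_prod => //; apply: Jb_gt0.
  - apply: leq_trans (exp_le_q x); rewrite !expnMn.
    have := bin_le x (s := t.+1); have := bin_le z (s := t.+1).
    have : K ^ z <= K ^ x by apply: leq_pexp2l; lia.
    have -> : t.+2 <= K by lia.
    move=> h /(_ isT) h1 /(_ isT) h2; have h3 := leq_trans h1 h.
    by rewrite mulnA [leqLHS]mulnC; apply: leq_mul => //; apply: leq_mul.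
  - by rewrite expn_gt0 q_gt0.
have large i : i \in J -> ~~ small i.
  by move=> iJ; have := nosmall i; rewrite iJ /= => ->.
have /card_gt0P[b bJ] : 0 < #|J| by lia.
have crJ' : cross F ([set b] :|: (J :\ b)) t.+1 by rewrite setD1K.
have bd1 f : f \in sel F [set b] -> #|inter [set b] f| < K + t.+1.
  by move=> fs; have := card_inter_le fs; rewrite cards1 => /(_ isT); lia.
have [x [z [_ _ N1 N2]]] :=
  cross_bound F_ne Hv (disjoint1D1 b J) crJ' bd1 (bd K b (Jb_gt0 b bJ) (leqnn K)).
rewrite !(split_b b bJ).
have := N1 z (leqnn z); rewrite !big_set1 => N1'.
apply: (leq_mul_decay N1' (N2 x (leqnn x)) (d1 := q ^ z) (d2 := q ^ x)).
- by apply: v_geo_large; apply: large.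
- rewrite -[x in q ^ x]muln1; apply: geo_prod; last exact: Jb_gt0.
  by move=> i; rewrite !inE => /andP[_ /large].
- apply: (@leq_trans ((K * K) ^ z * (K * K) ^ x)); last by apply: leq_mul; apply: exp_le_q1.
  rewrite !expnMn [leqRHS](_ : _ = (K ^ x * K ^ z) * (K ^ z * K ^ x)); last by lia.
  by apply: leq_mul; rewrite leq_mul2r bin_le ?orbT //; lia.
- by rewrite muln_gt0 !expn_gt0 q_gt0.
Qed.

Definition bound_or_extremal := exists a,
  \prod_i #|F i| < extremal_count a * \prod_(i in [set~ a]) v i t.+1 \/
  exists T, [/\ #|T| = t.+1, forall H, H \in F a -> t <= #|T :&: H|
              & forall i G, i != a -> G \in F i -> T \subset G].

Local Lemma prod_v_gt0 J : 0 < \prod_(i in J) v i t.+1.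
Proof. by rewrite prodn_cond_gt0. Qed.

Local Lemma card_setC1_gt1 (a : I) : 1 < #|[set~ a]|.
Proof. by rewrite cardsC1; lia. Qed.

Local Lemma disjoint1C (a : I) : [disjoint [set a] & [set~ a]].
Proof. by rewrite disjoints1 !inE eqxx. Qed.

(** Intersections over the other families are [t]-covers of [F a], hence have more than [t] blocks,
    and [cross_succ_bound] applies to those families. It remains to weigh [F a] by the size [t + x]
    of its smallest cover. *)
Lemma bound_no_core a : (forall A, #|A| = t -> ~~ cov F [set a] t A) -> bound_or_extremal.
Proof.
move=> nocore; set J := [set~ a].
have crU : cross F ([set a] :|: J) t by rewrite setUCr.
have Jgt0 : 0 < #|J| by have := card_setC1_gt1 a; rewrite -/J; lia.
have bd1 f : f \in sel F [set a] -> #|inter [set a] f| < K + t.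
  by move=> fs; have := card_inter_le fs; rewrite cards1 => /(_ isT); lia.
have bd2 f : f \in sel F J -> #|inter J f| < K + t.
  by move=> fs; have := card_inter_le fs Jgt0; lia.
have [x [z [[[T1 cT1 covT1] xmin] _ N1 N2]]] :=
  cross_bound F_ne Hv (disjoint1C a) crU bd1 bd2.
have aJ H f : H \in F a -> f \in sel F J -> t <= #|inter J f :&: H|.
  move=> HF fs; have Hs : [ffun j => if j == a then H else set0] \in sel F [set a].
    by apply/sel1P; exists H.
  have [h hs hE] := inter_merge (disjoint1C a) Hs fs.
  by have := crU h hs; rewrite hE inter1 ffunE eqxx setIC.
have x_gt0 : 0 < x.
  by rewrite lt0n; apply/eqP => x0; have := nocore T1; rewrite covT1 cT1 x0 addn0 => /(_ erefl).
have crJ : cross F J t.+1.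
  move=> f fs; suff /xmin : cov F [set a] t (inter J f) by lia.
  by apply/cov1P => H HF; apply: aJ.
have NJ := cross_succ_bound (card_setC1_gt1 a) crJ.
have win : #|F a| < extremal_count a -> bound_or_extremal.
  move=> lt; exists a; left; rewrite (prod_setC1 a).
  apply: leq_ltn_trans (leq_mul (leqnn _) NJ) _.
  by rewrite ltn_pmul2r // prod_v_gt0.
case: (ltnP 1 x) => [x_gt1|x_le1]; last first.
  have {}cT1 : #|T1| = t.+1 by rewrite cT1; lia.
  have /cov1P cov1 := covT1.
  case: (boolP [forall f in sel F J, T1 \subset inter J f]) => [/forall_inP allT|].
    exists a; right; exists T1; split=> // i G ia GF.
    have iJ : i \in J by rewrite !inE.
    have [f fs <-] := sel_through F_ne iJ GF.
    exact: subset_trans (allT f fs) (inter_sub f iJ).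
  rewrite negb_forall_in => /exists_inP[f fs /subsetPn[c cT cX]].
  apply: win; apply: (@leq_ltn_trans (v a t + t * (K * v a t.+1))); last first.
    rewrite /extremal_count ltn_add2l ltn_pmul2l //.
    have: K.+2 * v a t.+1 <= q * v a t.+1 by rewrite leq_mul2r q_gt orbT.
    by have := v_step a; have := v_gt0 a; lia.
  (* A member of [F a] misses at most one block of [T1]. If it misses [d] other than [c], it
     contains [T1 :\ d], which shares fewer than [t] blocks with [inter J f] because [c] lies
     outside; one branching step at cost [K] follows. *)
  have sub : F a \subset [set H in F a | T1 :\ c \subset H] :|:
      \bigcup_(d in T1 :\ c) [set H in F a | T1 :\ d \subset H].
    apply/subsetP => H HF; rewrite !inE HF /=.
    case: (boolP (T1 :\ c \subset H)) => //= /subsetPn[d dT dH].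
    apply/bigcupP; exists d => //; rewrite inE HF.
    by apply: (setD1_sub_of_card cT1) => //; [move: dT; rewrite inE => /andP[] | apply: cov1].
  apply: leq_trans (subset_leq_card sub) _; apply: leq_trans (leq_card_setU _ _) _.
  have cD := card_setD1_eq cT1.
  apply: leq_add; first by rewrite -(cD c cT); apply: Hv.
  apply: leq_trans (leq_card_bigcup _ _) _.
  apply: (@leq_trans (\sum_(d in T1 :\ c) K * v a t.+1)); last first.
    by rewrite sum_nat_const (cD c cT).
  apply: leq_sum => d; rewrite !inE => /andP[dc dT].
  apply: (branch_step (GG := F a) (phi := id) (s := t) (X := inter J f)).
  - by move=> H HF; rewrite setIC; apply: aJ.
  - exact: bd2.
  - rewrite -(cD d dT); apply: card_setI_lt; apply/subsetPn.
    by exists c => //; rewrite !inE eq_sym dc.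
  - move=> e eA; have <- : #|e |: T1 :\ d| = t.+1 by rewrite cardsU1 eA (cD d dT).
    exact: Hv.
case: (pickP (fun b => (b \in J) && small b)) => [b /andP[bJ sb]|nosmall].
  have [P PF] := set0Pn _ (F_ne b).
  have ba : b != a by rewrite !inE in bJ.
  have near H : H \in F a -> t <= #|H :&: P|.
    by move=> HF; apply: (card_inter2 crossF _ _ _ HF PF); rewrite ?inE // eq_sym.
  case: (boolP (small a)) => [sa|la].
    case: (near_small2 sa sb PF) => [lt|[T cT HT]].
      apply: win; apply: leq_ltn_trans lt; apply/subset_leq_card/subsetP => H HF.
      by rewrite inE HF near.
    have /xmin : cov F [set a] t T by apply/cov1P => H HF; apply: HT => //; apply: near.
    by rewrite cT; lia.
  have Fa : #|F a| <= 'C(t + 2, t) * v a t.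
    rewrite -(card_small sb PF); apply: (branch_from_cover (phi := id)) => [H HF|A _ cA].
      by rewrite setIC near.
    by rewrite -cA; apply: Hv.
  (* The distinguished index is the small [b], not [a]: its weight at [t.+1] is 1, and
     [v_large_small] trades [v a t] for [v b t]. *)
  exists b; left; rewrite (prod_setC1 a).
  apply: leq_ltn_trans (leq_mul Fa NJ) _.
  rewrite (big_setD1 b bJ) /= v_small // mul1n.
  have aJb : a \in [set~ b] by rewrite !inE eq_sym.
  rewrite (big_setD1 a aJb) /=.
  have -> : [set~ b] :\ a = J :\ b by apply/setP => i; rewrite !inE andbC.
  rewrite mulnA ltn_pmul2r ?prod_v_gt0 //.
  have := v_large_small la sb; have := v_step b; rewrite /extremal_count v_small // muln1.
  have -> : 'C(t + 2, t) = ((t + 2) * (t + 1))./2.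
    by rewrite -bin_sub ?leq_addr // addKn bin2 addnS.
  have := q_gt; have := v_gt0 a; have := v_step a.
  move: (v a t) (v a t.+1) (v b t) => A1 A2 B1 h1 h2 h3 h4 h5.
  have h6 : ((t + 2) * (t + 1))./2 * 2 <= (t + 2) * (t + 1) by rewrite muln2; lia.
  move: (_./2) h6 => C h6.
  have h7 : 2 * (C * A1) <= (t + 1) * (B1 * A2).
    apply: (@leq_trans ((t + 1) * (K * A1))); last by rewrite leq_mul2l h5 orbT.
    apply: (@leq_trans ((t + 2) * (t + 1) * A1)); first by nia.
    by rewrite [(t + 2) * _]mulnC -mulnA leq_mul2l leq_mul2r leK !orbT.
  have h8 : 2 * t < (t + 1) * B1 by nia.
  nia.
have large i : i \in J -> ~~ small i.
  by move=> iJ; have := nosmall i; rewrite iJ /= => ->.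
exists a; left; rewrite (prod_setC1 a).
apply: (@leq_ltn_trans (v a t * \prod_(i in J) v i t.+1)); last first.
  by rewrite ltn_pmul2r ?prod_v_gt0 // extremal_gt.
have := N1 z (leqnn z); have := N2 x (leqnn x); rewrite !big_set1.
have -> : t + x = t.+1 + x.-1 by lia.
move=> N2' N1'.
(* At least two families remain besides [a], so [x - 1] decaying steps gain [q ^ (2 * (x - 1))], at
   least [q ^ x] since [x >= 2]. *)
apply: (leq_mul_decay N1' N2' (d1 := q ^ z) (d2 := q ^ (x.-1 * 2))).
- exact: v_geo.
- by apply: geo_prod => //; apply: card_setC1_gt1.
- have -> : t.+1 + x.-1 = t + x by lia.
  apply: (@leq_trans ((K * K) ^ z * (K * K) ^ x)); last first.
    apply: leq_mul; first exact: exp_le_q1.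
    by apply: leq_trans (exp_le_q1 x) _; apply: leq_pexp2l; [apply: q_gt0 | lia].
  rewrite !expnMn [leqRHS](_ : _ = (K ^ x * K ^ z) * (K ^ z * K ^ x)); last by lia.
  by apply: leq_mul; rewrite leq_mul2r bin_le ?orbT //; lia.
- by rewrite muln_gt0 !expn_gt0 q_gt0.
Qed.

(** Some member of another family fails to contain the core of [F i], so one branching step gives a
    factor [K] over [v i t.+1]. The point is that this surplus is paid at most twice in the
    product. *)
Lemma bound_all_cores (core : I -> {set B}) :
    (forall i, #|core i| = t) -> (forall i G, G \in F i -> core i \subset G) ->
  \prod_i #|F i| <= K ^ 2 * \prod_i v i t.+1.
Proof.
move=> c_core s_core.
have cross2 i j G H : i != j -> G \in F i -> H \in F j -> t <= #|G :&: H|.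
  by move=> ij GF HF; apply: (card_inter2 crossF _ _ ij GF HF); rewrite inE.
have escape i : exists j, exists H, [/\ j != i, H \in F j & #|core i :&: H| < t].
  have [j [H HF nsub]] := nontrivF (c_core i).
  exists j, H; split=> //; last by rewrite -(c_core i); apply: card_setI_lt.
  by apply: contraNneq nsub => ji; apply: s_core; rewrite -ji.
have FE i : F i = [set G in F i | core i \subset G].
  by apply/setP => G; rewrite inE; case: (boolP (G \in F i)) => // /s_core ->.
have Kbound i : #|F i| <= K * v i t.+1.
  have [j [H [ji HF lt]]] := escape i.
  rewrite FE; apply: (branch_step (phi := id) (s := t) (X := H)) => //.
  - by move=> G GF; apply: cross2 GF HF; rewrite eq_sym.
  - by have := card_le HF; lia.
  - move=> e eA; have <- : #|e |: core i| = t.+1 by rewrite cardsU1 eA c_core.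
    exact: Hv.
pose Bad := [set i | v i t.+1 < #|F i|].
have bad_le2 : #|Bad| <= 2 -> \prod_i #|F i| <= K ^ 2 * \prod_i v i t.+1.
  move=> le2.
  apply: (@leq_trans (\prod_i ((if i \in Bad then K else 1) * v i t.+1))).
    apply: leq_prod => i _; case: ifPn => [_|]; first exact: Kbound.
    by rewrite inE -leqNgt mul1n.
  rewrite big_split /= -big_mkcond prod_nat_const leq_mul2r; apply/orP; right.
  by apply: leq_pexp2l => //; apply: leq_trans K_ge3.
case: (boolP [exists a, [exists T : {set B}, (#|T| == t.+1) && cov F [set~ a] t T]]).
  case/existsP => a /existsP[T /andP[/eqP cT /covP covT]].
  case: (pickP (fun b => (b != a) &&
      [forall i, (i != a) && (i != b) ==> [forall G in F i, T \subset G]])).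
    move=> b /andP[_ /forallP full]; apply: bad_le2.
    apply: (@leq_trans #|[set a; b]|); last by rewrite cards2; case: (_ != _).
    apply/subset_leq_card/subsetP => i; rewrite !inE; apply: contraLR.
    rewrite negb_or -leqNgt => iab; rewrite -cT; apply: card_full.
    by have := full i; rewrite iab => /forall_inP.
  move=> nob.
  have miss b : b != a -> exists i, exists2 G, G \in F i & [/\ i != a, i != b & ~~ (T \subset G)].
    move=> ba; have := nob b; rewrite ba /= => /negbT; rewrite negb_forall => /existsP[i].
    rewrite negb_imply negb_forall_in => /andP[/andP[ia ib] /exists_inP[G GF nT]].
    by exists i, G.
  have /card_gt0P[b0] : 0 < #|[set~ a]| by apply: ltnW (card_setC1_gt1 a).
  rewrite !inE => /miss[i1 [G1 G1F [i1a _ /subsetPn[c cinT cG1]]]].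
  have [i2 [G2 G2F [i2a i21 nTG2]]] := miss i1 i1a.
  have cD := card_setD1_eq cT cinT.
  (* An intersection avoiding [c] still shares [t] blocks with [T], hence contains all of [T :\ c].
     Two families with members avoiding [c] thus make [T :\ c] common to all families but [F a]. *)
  have forced i j G G' : i != a -> j != a -> i != j -> G \in F i -> G' \in F j ->
      c \notin G' -> T :\ c \subset G.
    move=> ia ja ij GF G'F cG'.
    have iJ : i \in [set~ a] by rewrite !inE.
    have jJ : j \in [set~ a] by rewrite !inE.
    have [f [fs fi fj]] := sel_through2 F_ne iJ jJ ij GF G'F.
    apply: (@subset_trans _ _ (inter [set~ a] f)); last by rewrite -fi inter_sub.
    apply: (setD1_sub_of_card cT) => //; last exact: covT.
    by apply: contra cG' => /(subsetP (inter_sub f jJ)); rewrite fj.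
  have cG2 : c \notin G2.
    apply: contra nTG2 => cG2; rewrite -(setD1K cinT) subUset sub1set cG2.
    exact: forced G2F G1F cG1.
  have all_core i G : i != a -> G \in F i -> T :\ c \subset G.
    move=> ia GF; have [E|i_i1] := eqVneq i i1; last exact: forced GF G1F cG1.
    by apply: forced GF G2F cG2; rewrite // E eq_sym.
  have [m [H HF nsub]] := nontrivF cD.
  have ma : m = a by apply/eqP; apply: contraNT nsub => ma; apply: all_core HF.
  rewrite {}ma in HF.
  (* By non-triviality [F a] has a member [H] not containing [T :\ c]; one branching step on [H]
     treats all other families jointly, at a single factor [K]. *)
  have NJ : \prod_(i in [set~ a]) #|F i| <= K * \prod_(i in [set~ a]) v i t.+1.
    rewrite -card_sel.
    have -> : sel F [set~ a] = [set f in sel F [set~ a] | T :\ c \subset inter [set~ a] f].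
      apply/setP => f; rewrite inE; case: (boolP (f \in _)) => // /selP[f1 _].
      symmetry; apply/bigcapsP => i iJ; apply: all_core (f1 i iJ); first by rewrite !inE in iJ.
    apply: (branch_step (phi := inter [set~ a]) (s := t) (X := H)).
    - move=> f fs; have Hs : [ffun j => if j == a then H else set0] \in sel F [set a].
        by apply/sel1P; exists H.
      have [h hs hE] := inter_merge (disjoint1C a) Hs fs.
      rewrite setUCr in hs hE.
      by have := crossF hs; rewrite hE inter1 ffunE eqxx setIC.
    - by have := card_le HF; lia.
    - by rewrite -cD; apply: card_setI_lt.
    - move=> e eA; have <- : #|e |: T :\ c| = t.+1 by rewrite cardsU1 eA cD.
      exact: card_sel_above.
  rewrite !(prod_setC1 a); apply: leq_trans (leq_mul (Kbound a) NJ) _.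
  by rewrite mulnACA mulnn.
rewrite negb_exists => /forallP nocov.
(* No [t.+1] blocks cover the other families, so a second branching step is possible; for a large
   family [K ^ 2] is absorbed by the decay from [t.+1] to [t + 2]. *)
have bad_small i : i \in Bad -> small i.
  rewrite inE; apply: contraLR => li; rewrite -leqNgt FE.
  apply: (@leq_trans (K ^ 2 * v i (t + 2))); last first.
    have := v_geo_large 1 li; rewrite expn1 addn1 addn2 => /(leq_trans _); apply.
    by rewrite leq_mul2r; apply/orP; right; apply: leq_trans leq_q; rewrite leq_pmull.
  rewrite -(c_core i); apply: (@branch _ _ _ id (v i) (Hv i) t) => A' sA' cA'.
  have [j [H [ji HF lt]]] := escape i.
  case: (leqP #|A'| t) => leA'.
    exists H; split.
    - by move=> G GF; apply: cross2 GF HF; rewrite eq_sym.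
    - by have := card_le HF; lia.
    - suff <- : core i = A' by [].
      by apply/eqP; rewrite eqEcard sA' c_core.
  have := nocov i; rewrite negb_exists => /forallP /(_ A').
  have -> : #|A'| == t.+1 by rewrite c_core in cA'; apply/eqP; lia.
  rewrite /= negb_forall_in => /exists_inP[f fs]; rewrite -ltnNge => lt'.
  exists (inter [set~ i] f); split=> //.
    move=> G GF; have Gs : [ffun j => if j == i then G else set0] \in sel F [set i].
      by apply/sel1P; exists G.
    have [h hs hE] := inter_merge (disjoint1C i) Gs fs.
    rewrite setUCr in hs hE.
    by have := crossF hs; rewrite hE inter1 ffunE eqxx.
  by have := card_inter_le fs (ltnW (card_setC1_gt1 i)); lia.
apply: bad_le2; rewrite leqNgt; apply/negP => /card_gt2P[i [j [l [[iB jB lB] [ij jl li]]]]].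
have bad_full i0 A : i0 \in Bad -> #|A| = t -> (forall G, G \in F i0 -> A \subset G) -> A = core i0.
  rewrite inE => i0B cA sA; apply/eqP; rewrite eqEcard cA c_core leqnn andbT.
  apply: contraTT i0B => /subsetPn[e eA eC]; rewrite -leqNgt.
  have <- : #|e |: core i0| = t.+1 by rewrite cardsU1 eC c_core.
  apply: card_full => G GF; rewrite subUset sub1set s_core // andbT.
  by apply: (subsetP (sA G GF)).
have far i0 b P : i0 \in Bad -> b \in Bad -> P \in F b ->
    exists2 G, G \in F i0 & #|G :&: P| <= t.
  move=> i0B /bad_small sb PF; apply/exists_inP; move: i0B; rewrite inE; apply: contraTT.
  rewrite negb_exists_in -leqNgt => /forall_inP near.
  apply: leq_trans (near_small i0 sb PF); apply/subset_leq_card/subsetP => G GF.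
  by rewrite inE GF ltnNge near.
(* Given [G] in [F j], a far member [G'] of [F l] shares exactly [t] blocks with it. Every member of
   [F i] must contain these blocks, so they form [core i]; hence [core i] lies in every [G]. *)
have eq_core : core i = core j.
  apply: (bad_full) => // G GF; have [G' G'F le] := far l j G lB jB GF.
  suff -> : core i = G' :&: G by rewrite subsetIr.
  symmetry; have sub G1 : G1 \in F i -> G' :&: G \subset G1.
    move=> G1F; have [|f [fs fi fj fl]] := @sel_through3 _ _ F F_ne [set: I] i j l G1 G G' _
      (And3 ij jl li) (And3 G1F GF G'F); first by rewrite !inE.
    suff /eqP <- : inter [set: I] f == G' :&: G by rewrite -fi inter_sub ?inE.
    rewrite eqEcard subsetI -fj -fl !inter_sub ?inE // fj fl.
    exact: leq_trans le (crossF fs).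
  apply: (bad_full) => //; apply/eqP; rewrite eqn_leq le.
  by rewrite setIC; apply: cross2 GF G'F.
have [m [H HF nsub]] := nontrivF (c_core i).
have mi : m != i by apply: contraNneq nsub => E; apply: s_core; rewrite -E.
have jm : j != m.
  by apply: contraNneq nsub => E; rewrite eq_core; apply: s_core; rewrite E.
have [P PF] := set0Pn _ (F_ne j).
have [G GF] := far i j P iB jB PF; rewrite leqNgt => /negP; apply.
have [|f [fs fi fj fm]] := @sel_through3 _ _ F F_ne [set: I] i j m G P H _
  (And3 ij jm mi) (And3 GF PF HF); first by rewrite !inE.
have nI : ~~ (core i \subset inter [set: I] f).
  by apply: contra nsub => /subset_trans; apply; rewrite -fm inter_sub ?inE.
(* The intersection through [G], [P] and [H] has at least [t] blocks but does not contain the common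
   core, so it has a block outside it. Then [G] and [P] share [t.+1] blocks, contrary to their
   choice. *)
have: ~~ (inter [set: I] f \subset core i).
  apply: contra nI => sub; suff /eqP <- : inter [set: I] f == core i by [].
  by rewrite eqEcard sub c_core crossF.
case/subsetPn => e ef ec; rewrite -(c_core i).
have <- : #|e |: core i| = #|core i|.+1 by rewrite cardsU1 ec.
apply: subset_leq_card; rewrite subUset sub1set subsetI s_core // eq_core s_core // andbT inE.
by rewrite -fi -fj !(subsetP (inter_sub f (in_setT _)) _ ef).
Qed.

Theorem abstract_bound : bound_or_extremal.
Proof.
case: (boolP [exists a, [forall A : {set B}, (#|A| == t) ==> ~~ cov F [set a] t A]]).
  case/existsP => a /forallP nocore; apply: (@bound_no_core a) => A /eqP cA.
  by have := nocore A; rewrite cA.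
rewrite negb_exists => /forallP cores.
have /fin_all_exists[core coreP] i : exists A : {set B}, #|A| = t /\ forall G, G \in F i -> A \subset G.
  have := cores i; rewrite negb_forall => /existsP[A].
  rewrite negb_imply negbK => /andP[/eqP cA /cov1P covA]; exists A; split=> // G GF.
  apply/setIidPl/eqP; rewrite eqEcard subsetIl cA; exact: covA.
have N := bound_all_cores (fun i => (coreP i).1) (fun i => (coreP i).2).
have /card_gt0P[a _] : 0 < #|I| by lia.
exists a; left; apply: leq_ltn_trans N _; rewrite (prod_setC1 a) mulnA.
rewrite ltn_pmul2r ?prod_v_gt0 //; apply: leq_ltn_trans (extremal_gt a).
apply: leq_trans (v_step a); rewrite leq_mul2r; apply/orP; right.
by apply: leq_trans leq_q; rewrite leq_pmull.
Qed.

End AbstractBound.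

(** * Counting partitions *)

Section PartitionCount.

Variable T : finType.
Implicit Types (k : nat) (D B C : {set T}) (P Q A : {set {set T}}).

Definition parts D (k : nat) : {set {set {set T}}} :=
  [set P | partition P D & #|P| == k].

Lemma partsP D k P : reflect (partition P D /\ #|P| = k) (P \in parts D k).
Proof. by rewrite inE; apply: (iffP andP) => -[h /eqP]. Qed.

Lemma notin_partition P D B : partition P D -> ~~ (B \subset D) -> B \notin P.
Proof. by move=> pP; apply: contra => /(partitionS pP). Qed.

Lemma card_parts_with_singleton D k x : x \in D ->
  #|[set P in parts D k.+1 | [set x] \in P]| = #|parts (D :\ x) k|.
Proof.
move=> xD; have nx Q (k' : nat) : Q \in parts (D :\ x) k' -> [set x] \notin Q.
  by case/partsP=> pQ _; apply: notin_partition pQ _; rewrite sub1set !inE eqxx.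
have -> : [set P in parts D k.+1 | [set x] \in P] =
    (fun Q => [set x] |: Q) @: parts (D :\ x) k.
  apply/setP => P; rewrite inE; apply/andP/imsetP => [[/partsP[pP cP] xP]|[Q Qp ->]].
    exists (P :\ [set x]); last by rewrite setD1K.
    apply/partsP; split; first exact: partitionD1.
    by have := cardsD1 [set x] P; rewrite xP cP add1n => -[].
  rewrite setU11; split=> //; have nQ := nx _ _ Qp; case/partsP: Qp => pQ cQ.
  apply/partsP; rewrite cardsU1 nQ cQ; split=> //.
  rewrite -(setD1K xD); apply: partitionU1 => //; first by rewrite -card_gt0 cards1.
  by rewrite disjoints1 !inE eqxx.
apply: card_in_imset => Q1 Q2 /nx n1 /nx n2 E.
by rewrite -(setU1K n1) -(setU1K n2) E.
Qed.

(** Deleting [x] from its block gives a partition of [D :\ x] with a marked block; the pairs in [S]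
    record this, and [h] puts [x] back into the marked block. *)
Lemma card_parts_without_singleton D k x : x \in D ->
  #|[set P in parts D k | [set x] \notin P]| = k * #|parts (D :\ x) k|.
Proof.
move=> xD; set D' := D :\ x.
pose S := [set QC : {set {set T}} * {set T} | (QC.1 \in parts D' k) && (QC.2 \in QC.1)].
have <- : #|S| = k * #|parts D' k|.
  rewrite -sum1_card (eq_bigl (fun QC => (QC.1 \in parts D' k) && (QC.2 \in QC.1))); last first.
    by move=> QC; rewrite inE.
  rewrite -(pair_big_dep (fun Q => Q \in parts D' k) (fun Q C => C \in Q) (fun _ _ => 1)) /=.
  rewrite mulnC -sum_nat_const; apply: eq_bigr => Q /partsP[_ <-].
  by rewrite sum1_card.
pose h QC : {set {set T}} := (x |: QC.2) |: (QC.1 :\ QC.2).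
have hP QC : QC \in S -> [/\ h QC \in parts D k, [set x] \notin h QC,
    x \notin QC.2, x |: QC.2 \notin QC.1 & x |: QC.2 \in h QC].
  case: QC => Q C; rewrite inE /h /= => /andP[/partsP[pQ cQ] CQ].
  have xC : x \notin C by apply/negP => /(subsetP (partitionS pQ CQ)); rewrite !inE eqxx.
  have nxC : x |: C \notin Q.
    by apply: notin_partition pQ _; apply/subsetPn; exists x; rewrite !inE eqxx.
  split=> //; last by rewrite setU11.
    apply/partsP; split.
      have -> : D = (x |: C) :|: (D' :\: C).
        apply/setP => y; rewrite !inE; have := subsetP (partitionS pQ CQ) y; rewrite !inE.
        have [->|] := eqVneq y x; first by rewrite xD.
        by case: (y \in C) => //= _ /(_ isT).
      apply: partitionU1; first exact: partitionD1.
        by apply/set0Pn; exists x; rewrite !inE eqxx.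
      rewrite -setI_eq0; apply/eqP/setP => y; rewrite !inE.
      by case: (y == x); case: (y \in C).
    have := cardsD1 C Q; rewrite CQ cQ => cE.
    by rewrite cardsU1 !inE (negbTE nxC) andbF [RHS]cE.
  rewrite !inE negb_or negb_and negbK; apply/andP; split.
    have /set0Pn[y yC] := partition_neq0 pQ CQ; apply/eqP => /setP /(_ y).
    by rewrite !inE yC orbT => /eqP yx; rewrite -yx yC in xC.
  by apply/orP; right; apply: notin_partition pQ _; rewrite sub1set !inE eqxx.
have -> : [set P in parts D k | [set x] \notin P] = h @: S.
  apply/setP => P; rewrite inE; apply/andP/imsetP => [[/partsP[pP cP] nxP]|[QC QCS ->]]; last first.
    by case: (hP _ QCS).
  pose B := pblock P x.
  have xcov : x \in cover P by rewrite (cover_partition pP).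
  have BP : B \in P by apply: pblock_mem.
  have xB : x \in B by rewrite mem_pblock.
  have nC : B :\ x \notin P.
    apply/negP => CP; have /set0Pn[y yC] := partition_neq0 pP CP.
    have yB : y \in B by move: yC; rewrite !inE => /andP[].
    have := def_pblock (partition_trivIset pP) CP yC.
    rewrite (def_pblock (partition_trivIset pP) BP yB) => E.
    by move: xB; rewrite E !inE eqxx.
  have C0 : B :\ x != set0.
    apply: contraNneq nxP => C0; suff -> : [set x] = B by [].
    by rewrite -(setD1K xB) C0 setU0.
  exists ((B :\ x) |: (P :\ B), B :\ x); last first.
    by rewrite /h /= setD1K // setU1K ?setD1K // !inE negb_and nC orbT.
  rewrite inE /= setU11 andbT; apply/partsP; split.
    have -> : D' = (B :\ x) :|: (D :\: B).
      apply/setP => y; rewrite !inE; have := subsetP (partitionS pP BP) y.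
      have [->|] := eqVneq y x; first by rewrite xB.
      by case: (y \in B) => //= _ /(_ isT) ->.
    apply: partitionU1 => //; first exact: partitionD1.
    rewrite -setI_eq0; apply/eqP/setP => y; rewrite !inE.
    by case: (y \in B); rewrite ?andbF.
  have := cardsD1 B P; rewrite BP cP => cE.
  by rewrite cardsU1 !inE (negbTE nC) andbF [RHS]cE.
apply: card_in_imset => -[Q1 C1] [Q2 C2] S1 S2 E.
have [/partsP[p1 _] _ x1 n1 in1] := hP _ S1; have [_ _ x2 n2 in2] := hP _ S2.
rewrite /= in x1 n1 in1 x2 n2 in2.
have EC : x |: C1 = x |: C2.
  rewrite -E in in2.
  rewrite -(def_pblock (x := x) (partition_trivIset p1) in1) ?setU11 //.
  by rewrite (def_pblock (x := x) (partition_trivIset p1) in2) ?setU11.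
have EC' : C1 = C2 by rewrite -(setU1K x1) EC setU1K.
move: E S1 S2; rewrite /h /= -{}EC' => E.
rewrite !inE /= => /andP[_ c1] /andP[_ c2].
have m1 : x |: C1 \notin Q1 :\ C1 by rewrite !inE negb_and n1 orbT.
have m2 : x |: C1 \notin Q2 :\ C1 by rewrite EC !inE negb_and n2 orbT.
by rewrite -(setD1K c1) -(setD1K c2) -(setU1K m1) E setU1K.
Qed.

Lemma card_parts D k : #|parts D k| = s2 #|D| k.
Proof.
move cD: #|D| => n; elim: n D k cD => [|n IHn] D k cD.
  have -> : D = set0 by apply/eqP; rewrite -cards_eq0 cD.
  case: k => [|k].
    apply: etrans (cards1 (set0 : {set {set T}})); apply: eq_card => P.
    rewrite !inE partition_set0; case: eqP => // ->; by rewrite cards0.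
  apply/eqP; rewrite s2_gt // cards_eq0; apply/eqP/setP => P.
  by rewrite !inE partition_set0; case: eqP => // ->; rewrite cards0.
case: k => [|k].
  rewrite s2_n0; apply/eqP; rewrite cards_eq0; apply/eqP/setP => P; rewrite !inE.
  apply/negP => /andP[/card_partition]; rewrite cD => h; rewrite cards_eq0 => /eqP P0.
  by move: h; rewrite P0 big_set0.
have /card_gt0P[x xD] : 0 < #|D| by rewrite cD.
have cD' : #|D :\ x| = n by have := cardsD1 x D; rewrite xD cD add1n => -[].
rewrite s2S -(IHn _ _ cD') -(IHn _ _ cD') addnC.
rewrite -card_parts_with_singleton // -card_parts_without_singleton //.
rewrite -(cardsID [set P : {set {set T}} | [set x] \in P]); congr (_ + _); apply: eq_card => P.
  by rewrite !inE.
by rewrite !inE andbC.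
Qed.

Lemma card_parts_above D A k : partition A (cover A) -> cover A \subset D -> #|A| <= k ->
  #|[set P in parts D k | A \subset P]| = s2 (#|D| - #|cover A|) (k - #|A|).
Proof.
move=> pA sA cA; have <- : #|D :\: cover A| = #|D| - #|cover A| by rewrite cardsD (setIidPr sA).
rewrite -card_parts.
have dA Q (k' : nat) : Q \in parts (D :\: cover A) k' -> [disjoint A & Q].
  case/partsP => pQ _; rewrite -setI_eq0; apply/eqP/setP => B; rewrite !inE.
  apply/negP => /andP[BA BQ]; have /set0Pn[y yB] := partition_neq0 pA BA.
  have := subsetP (partitionS pQ BQ) y yB; rewrite inE => /andP[/negP ny _].
  by apply: ny; apply/bigcupP; exists B.
have -> : [set P in parts D k | A \subset P] =
    (fun Q => A :|: Q) @: parts (D :\: cover A) (k - #|A|).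
  apply/setP => P; rewrite inE; apply/andP/imsetP => [[/partsP[pP cP] sAP]|[Q Qp ->]].
    exists (P :\: A); last by rewrite -{1}(setID P A) (setIidPr sAP).
    apply/partsP; rewrite cardsD (setIidPr sAP) cP; split=> //; apply/and3P; split.
    - apply/eqP/setP => y; rewrite inE -(cover_partition pP).
      apply/bigcupP/andP => [[B]|[ny /bigcupP[B BP yB]]].
        rewrite inE => /andP[nBA BP] yB; split; last by apply/bigcupP; exists B.
        apply/negP => /bigcupP[C CA yC]; move: nBA.
        rewrite -(def_pblock (partition_trivIset pP) BP yB).
        by rewrite (def_pblock (partition_trivIset pP) (subsetP sAP C CA) yC) CA.
      exists B => //; rewrite inE BP andbT; apply: contra ny => BA.
      by apply/bigcupP; exists B.
    - by apply: trivIsetD; apply: partition_trivIset pP.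
    - by rewrite inE (partition0 pP) andbF.
  have dAQ := dA _ _ Qp; case/partsP: Qp => pQ cQ.
  rewrite subsetUl; split=> //; apply/partsP; split.
    apply/and3P; split.
    - by rewrite /cover bigcup_setU -!/(cover _) (cover_partition pQ)
        -{1}(setIidPr sA) setID.
    - apply: trivIsetU; [exact: partition_trivIset pA | exact: partition_trivIset pQ |].
      by rewrite (cover_partition pQ) -setI_eq0; apply/eqP/setP => y; rewrite !inE; case: (y \in _).
    - by rewrite inE (partition0 pA) (partition0 pQ).
  by rewrite cardsU (disjoint_setI0 dAQ) cards0 cQ subn0 subnKC.
apply: card_in_imset => Q1 Q2 Q1p Q2p E.
have d1 := dA _ _ Q1p; have d2 := dA _ _ Q2p.
have DE Q : [disjoint A & Q] -> (A :|: Q) :\: A = Q.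
  move=> d; apply/setP => B; rewrite !inE; case: (boolP (B \in A)) => //= BA.
  by rewrite (disjointFr d BA).
by rewrite -(DE Q1) // -(DE Q2) // E.
Qed.
End PartitionCount.

Lemma stirlingE n k : stirling n k = s2 n k.
Proof. by rewrite /stirling -[Pi n k]/(parts _ k) card_parts cardsT card_ord. Qed.

(** * Partitions containing given blocks *)

Section CountAbove.

Variable n : nat.
Implicit Types (k m t : nat) (P Q A T : {set {set 'I_n}}).

Definition above k A := [set P in Pi n k | A \subset P].

Lemma PiP k P : reflect (partition P [set: 'I_n] /\ #|P| = k) (P \in Pi n k).
Proof. exact: partsP. Qed.

Lemma sub_partition (D : {set 'I_n}) P A : partition P D -> A \subset P -> partition A (cover A).
Proof.
move=> pP sA; rewrite /partition eqxx (trivIsetS sA (partition_trivIset pP)) /=.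
by apply: contraFN (partition0 pP) => /(subsetP sA).
Qed.

Lemma card_above_partition k A : partition A (cover A) -> #|A| <= k ->
  #|above k A| = s2 (n - \sum_(B in A) #|B|) (k - #|A|).
Proof.
move=> pA cA; rewrite /above -[Pi n k]/(parts _ k) card_parts_above ?subsetT //.
by rewrite cardsT card_ord (card_partition pA).
Qed.

Lemma card_above_sub k k' P A : P \in Pi n k' -> A \subset P -> #|A| <= k ->
  #|above k A| = s2 (\sum_(B in P :\: A) #|B|) (k - #|A|).
Proof.
case/PiP=> pP _ sA cA; rewrite (card_above_partition (sub_partition pP sA) cA).
have := card_partition pP; rewrite cardsT card_ord (big_setID A) /= (setIidPr sA) => nE.
by congr (s2 _ _); rewrite [X in X - _]nE addKn.
Qed.

Lemma card_above_le k A m : #|A| < k ->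
    (forall P, P \in Pi n k -> A \subset P -> m <= \sum_(B in A) #|B|) ->
  #|above k A| <= s2 (n - m) (k - #|A|).
Proof.
move=> cA hm; have [->|/set0Pn[P]] := eqVneq (above k A) set0; first by rewrite cards0.
rewrite inE => /andP[PP sA]; have {}hm := hm P PP sA.
case/PiP: PP => pP _; rewrite (card_above_partition (sub_partition pP sA) (ltnW cA)).
by apply: leq_s2; [rewrite subn_gt0 | apply: leq_sub2l].
Qed.

Lemma leq_card_sum k P A : P \in Pi n k -> A \subset P -> #|A| <= \sum_(B in A) #|B|.
Proof.
case/PiP=> pP _ /subsetP sA; rewrite -sum1_card; apply: leq_sum => B /sA BP.
by rewrite card_gt0 (partition_neq0 pP BP).
Qed.

Lemma card_above_le_card k A : #|A| < k -> #|above k A| <= s2 (n - #|A|) (k - #|A|).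
Proof. by move=> cA; apply: card_above_le => // P PP; apply: leq_card_sum PP. Qed.

Lemma card_above_le1 k A : k <= #|A| -> #|above k A| <= (#|A| == k).
Proof.
move=> kA; have [->|/set0Pn[P]] := eqVneq (above k A) set0; first by rewrite cards0.
have sE Q : Q \in above k A -> Q = A.
  rewrite inE => /andP[/PiP[_ cQ] sA]; apply/eqP; rewrite eq_sym eqEcard sA cQ; exact: kA.
move=> PA; have EP := sE P PA; rewrite inE EP in PA.
case/andP: PA => /PiP[_ ->] _; rewrite eqxx; apply: (@leq_trans #|[set A]|); last by rewrite cards1.
by apply/subset_leq_card/subsetP => Q /sE ->; rewrite inE.
Qed.

Lemma card_above_singletons k A : (forall B, B \in A -> #|B| = 1) -> #|A| <= k ->
  #|above k A| = s2 (n - #|A|) (k - #|A|).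
Proof.
move=> A1 cA; rewrite card_above_partition //.
  by rewrite -sum1_card; congr (s2 (n - _) _); apply: eq_bigr.
rewrite /partition eqxx /=; apply/andP; split; last first.
  by apply/negP => /A1; rewrite cards0.
apply/trivIsetP => B C BA CA.
have /eqP/cards1P[x ->] := A1 B BA; have /eqP/cards1P[y ->] := A1 C CA => ne.
by rewrite disjoints1 inE; apply: contraNneq ne => ->.
Qed.

Lemma sum_s2_superadd (X : finType) (S : {set X}) (p : X -> nat) l : 1 < l ->
    (forall c, c \in S -> 0 < p c) ->
  \sum_(c in S) s2 (p c) l <= s2 ((\sum_(c in S) p c).+1 - #|S|) l.
Proof.
move=> l_gt1 p_gt0; rewrite -!big_enum /= cardE.
have: all (fun c => 0 < p c) (enum S) by apply/allP => c; rewrite mem_enum => /p_gt0.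
suff H r : all (fun c => 0 < p c) r -> size r <= \sum_(c <- r) p c /\
    \sum_(c <- r) s2 (p c) l <= s2 ((\sum_(c <- r) p c).+1 - size r) l.
  by case/H.
elim: r => [|c r IHr] /=; first by rewrite !big_nil.
case/andP => c_gt0 /IHr[h1 h2]; rewrite !big_cons; split; first by lia.
apply: leq_trans (leq_add (leqnn _) h2) _.
have := @s2_superadd (p c) ((\sum_(j <- r) p j).+1 - size r) l l_gt1 c_gt0.
move: (\sum_(j <- r) p j) h1 => a h1.
have -> : p c + (a.+1 - size r) - 1 = (p c + a).+1 - (size r).+1 by lia.
by apply; lia.
Qed.

(** Such a [G] contains [P :\ c] for some [c], which leaves [S(|c|, k - t - 1)] choices;
    superadditivity sums these over the blocks of [P]. It needs [k - t - 1 > 1], and for [k = t + 2]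
    only [G = P] is possible. *)
Lemma card_near_le t k P : t + 2 <= k -> t + 2 <= n -> P \in Pi n (t + 2) ->
  #|[set G in Pi n k | t.+1 <= #|G :&: P|]| <= s2 (n - t - 1) (k - t - 1).
Proof.
move=> tk tn PP; have [pP cP] := PiP _ _ PP.
have subP G : t.+1 <= #|G :&: P| -> exists2 c, c \in P & P :\ c \subset G.
  case: (boolP (P \subset G)) => [sPG _|/subsetPn[c cinP cG] le].
    have /card_gt0P[c cinP] : 0 < #|P| by rewrite cP addn2.
    by exists c => //; apply: subset_trans sPG; apply: subsetDl.
  exists c => //; apply: (@setD1_sub_of_card _ _ _ _ t.+1) => //; first by rewrite cP addn2.
  by rewrite setIC.
have sub : [set G in Pi n k | t.+1 <= #|G :&: P|] \subset \bigcup_(c in P) above k (P :\ c).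
  apply/subsetP => G; rewrite inE => /andP[GP /subP[c cinP sG]].
  by apply/bigcupP; exists c => //; rewrite inE GP.
have cD c : c \in P -> #|P :\ c| = t.+1.
  by apply: card_setD1_eq; rewrite cP addn2.
move: tk; rewrite leq_eqVlt => /orP[/eqP kE|tk].
  have -> : s2 (n - t - 1) (k - t - 1) = 1.
    have -> : k - t - 1 = 1 by lia.
    have -> : n - t - 1 = (n - t - 2).+1 by lia.
    exact: s2_1.
  rewrite -(cards1 P); apply/subset_leq_card/subsetP => G GP; rewrite inE; apply/eqP.
  have /bigcupP[c cinP Gc] := subsetP sub G GP.
  have Pc : P \in above k (P :\ c) by rewrite inE -kE PP subsetDl.
  suff /card_le1_eqP : #|above k (P :\ c)| <= 1 by apply.
  apply: leq_trans (card_above_le_card _) _; rewrite (cD c cinP); first by lia.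
  have -> : k - t.+1 = 1 by lia.
  have -> : n - t.+1 = (n - t - 2).+1 by lia.
  by rewrite s2_1.
apply: leq_trans (subset_leq_card sub) _; apply: leq_trans (leq_card_bigcup _ _) _.
apply: (@leq_trans (\sum_(c in P) s2 #|c| (k - t - 1))).
  apply: leq_sum => c cinP; rewrite (card_above_sub PP) ?subsetDl ?(cD c cinP) //; last by lia.
  have -> : P :\: (P :\ c) = [set c].
    by apply/setP => B; rewrite !inE; case: eqP => [->|_]; rewrite ?cinP // andNb.
  by rewrite big_set1 subnS subn1.
apply: leq_trans (sum_s2_superadd _ _) _; first by lia.
  by move=> c cinP; rewrite card_gt0 (partition_neq0 pP cinP).
rewrite -(card_partition pP) cardsT card_ord cP; apply: leq_s2; lia.
Qed.

End CountAbove.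

(** * Partitions sharing at least [t] blocks with a given set *)

Section CountMeeting.

Variable n : nat.
Implicit Types (k m t : nat) (P Q A T : {set {set 'I_n}}).

Definition meeting t k T := [set P in Pi n k | t <= #|T :&: P|].

Lemma meeting_cover t k T c0 : #|T| = t.+1 ->
  meeting t k T \subset above k (T :\ c0) :|:
    \bigcup_(c in T :\ c0) (above k (T :\ c) :\: above k T).
Proof.
move=> cT; apply/subsetP => P; rewrite !inE => /andP[PP tP]; rewrite PP /=.
case: (boolP (T :\ c0 \subset P)) => //= /subsetPn[c cT0 cP].
have cinT : c \in T by move: cT0; rewrite inE => /andP[].
apply/bigcupP; exists c => //; rewrite !inE PP /= (setD1_sub_of_card cT cinT cP tP) andbT.
by apply/subsetPn; exists c.
Qed.

Lemma card_meeting_cover t k T c0 a b : #|T| = t.+1 -> c0 \in T ->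
    #|above k (T :\ c0)| <= a ->
    (forall c, c \in T :\ c0 -> #|above k (T :\ c) :\: above k T| <= b) ->
  #|meeting t k T| <= a + t * b.
Proof.
move=> cT c0T ha hb; apply: leq_trans (subset_leq_card (meeting_cover k c0 cT)) _.
apply: leq_trans (leq_card_setU _ _) _; apply: leq_add => //.
apply: leq_trans (leq_card_bigcup _ _) _.
by rewrite -(card_setD1_eq cT c0T) -sum_nat_const; apply: leq_sum.
Qed.

Lemma card_meeting_singletons t k T : #|T| = t.+1 -> (forall B, B \in T -> #|B| = 1) ->
    t + 2 <= k ->
  #|meeting t k T| <= s2 (n - t) (k - t) + t * (s2 (n - t) (k - t) - s2 (n - t - 1) (k - t - 1)).
Proof.
move=> cT T1 tk; have /card_gt0P[c0 c0T] : 0 < #|T| by rewrite cT.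
have cD c : c \in T -> #|above k (T :\ c)| = s2 (n - t) (k - t).
  move=> cinT; rewrite card_above_singletons ?(card_setD1_eq cT cinT) //; last by lia.
  by move=> B; rewrite inE => /andP[_ /T1].
apply: (card_meeting_cover cT c0T); first by rewrite cD.
move=> c; rewrite inE => /andP[_ cinT]; rewrite cardsD (setIidPr _).
  rewrite cD // [#|above k T|]card_above_singletons // cT; last by lia.
  by rewrite !subnS !subn0.
apply/subsetP => P; rewrite !inE => /andP[-> /= sT].
by apply: subset_trans sT; apply: subsetDl.
Qed.

(** Every [T :\ c] with [c] other than [c0] retains [c0], a block of at least two points, hence
    occupies at least [t + 1] points and leaves at most [n - t - 1]. *)
Lemma card_meeting_nonsingleton t k k0 T c0 P0 : #|T| = t.+1 -> c0 \in T -> #|c0| != 1 ->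
    P0 \in Pi n k0 -> T \subset P0 -> t + 2 <= k ->
  #|meeting t k T| <= s2 (n - t) (k - t) + t * s2 (n - t - 1) (k - t).
Proof.
move=> cT c0T c0_1 P0P sT tk; have cD := card_setD1_eq cT.
apply: (card_meeting_cover cT c0T) => [|c].
  by apply: leq_trans (card_above_le_card _) _; rewrite (cD c0 c0T) //; lia.
rewrite inE => /andP[c_c0 cinT].
apply: leq_trans (subset_leq_card (subsetDl _ _)) _.
have h := @card_above_le n k (T :\ c) (t + 1).
rewrite (cD c cinT) subnDA in h; apply: h; first by lia.
move=> P PP sP; rewrite inE eq_sym in c_c0.
have c0D : c0 \in T :\ c by rewrite !inE c_c0.
rewrite (big_setD1 c0 c0D) /=.
have c0_gt1 : 1 < #|c0|.
  have: 0 < #|c0|; last by move: (#|c0|) c0_1 => [|[]].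
  have [pP _] := PiP _ _ P0P; rewrite card_gt0.
  exact: partition_neq0 pP (subsetP sT _ c0T).
have := leq_card_sum PP (subset_trans (subsetDl _ [set c0]) sP).
have : #|(T :\ c) :\ c0| = t.-1.
  by have := cardsD1 c0 (T :\ c); rewrite c0D (cD c cinT) => ->.
by move=> -> h; apply: leq_trans (leq_add c0_gt1 h); lia.
Qed.

(** The recurrence gives [V - W = (k - t) * S(n - t - 1, k - t)] for the two Stirling numbers on the
    right, and [k - t >= 2] makes the comparison strict. *)
Lemma card_meeting_nonsingleton_lt t k k0 T c0 P0 : 0 < t -> k <= n.-1 -> #|T| = t.+1 ->
    c0 \in T -> #|c0| != 1 -> P0 \in Pi n k0 -> T \subset P0 -> t + 2 <= k ->
  #|meeting t k T| < s2 (n - t) (k - t) + t * (s2 (n - t) (k - t) - s2 (n - t - 1) (k - t - 1)).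
Proof.
move=> t_gt0 kn cT c0T c0_1 P0P sT tk.
apply: leq_ltn_trans (card_meeting_nonsingleton cT c0T c0_1 P0P sT tk) _.
rewrite ltn_add2l ltn_pmul2l //.
have [l lE] : exists l, k - t = l.+2 by exists (k - t - 2); lia.
have [N NE] : exists N, n - t = N.+1 by exists (n - t).-1; lia.
rewrite lE NE !subn1 /= s2S addnK.
have : 0 < s2 N l.+2 by apply: s2_gt0; lia.
by nia.
Qed.

(** A partition sharing [t] blocks with [P] either shares [t] blocks with [T], the set of all blocks
    of [P] but a largest one [y], or contains [y] and [t - 1] blocks of [T]. *)
Lemma card_near2 K t P : 32 * K ^ (2 * K) <= 2 ^ (n + K) -> 0 < t -> t + 2 <= K ->
    P \in Pi n (t + 2) ->
  #|[set H in Pi n (t + 2) | t <= #|H :&: P|]| < s2 (n - t) 2 + t * (s2 (n - t) 2 - 1) \/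
  exists2 T : {set {set 'I_n}}, #|T| = t.+1 &
    forall H, H \in Pi n (t + 2) -> t <= #|H :&: P| -> t <= #|T :&: H|.
Proof.
move=> nK t_gt0 tK PP; have K3 : 3 <= K by lia.
have nl := n_large K3 nK; have [pP cP] := PiP _ _ PP.
have /card_gt0P[y0 y0P] : 0 < #|P| by rewrite cP addn2.
case: (@arg_maxnP _ y0 (fun y => y \in P) (fun y => #|y|) y0P) => y yP ymax.
set T := P :\ y; have cT : #|T| = t.+1 by apply: card_setD1_eq; rewrite ?cP ?addn2.
have sTP : T \subset P by apply: subsetDl.
have yT : y \notin T by rewrite !inE eqxx.
have sPA A : A \subset T -> #|A| = t.-1 -> exists u, exists w,
    [/\ u != w, u \in P, w \in P & P :\: (y |: A) = [set u; w]].
  move=> sA cA; have : #|P :\: (y |: A)| == 2.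
    rewrite cardsD (setIidPr _); last first.
      by rewrite subUset sub1set yP (subset_trans sA).
    rewrite cardsU1 cA cP; have -> : y \notin A by apply: contra yT => /(subsetP sA).
    by apply/eqP; lia.
  case/cards2P => u [w [uw E]]; exists u, w.
  by split=> //; apply: (subsetP (subsetDl P (y |: A))); rewrite E !inE eqxx ?orbT.
have cyA A : A \subset T -> #|A| = t.-1 -> #|y |: A| = t.
  move=> sA cA; rewrite cardsU1 cA; have -> : y \notin A by apply: contra yT => /(subsetP sA).
  by rewrite add1n prednK.
have syA A : A \subset T -> y |: A \subset P.
  by move=> sA; rewrite subUset sub1set yP (subset_trans sA).
have card_yA A : A \subset T -> #|A| = t.-1 ->
    #|above (t + 2) (y |: A)| = s2 (\sum_(B in P :\: (y |: A)) #|B|) 2.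
  move=> sA cA; have := @card_above_sub n (t + 2) (t + 2) P (y |: A) PP (syA A sA).
  by rewrite (cyA A sA cA) leq_addr addKn; apply.
have H_split (H : {set {set 'I_n}}) : t <= #|H :&: P| -> ~~ (t <= #|T :&: H|) ->
    exists2 A : {set {set 'I_n}}, A \subset T /\ #|A| = t.-1 & y |: A \subset H.
  rewrite -ltnNge => hP hT.
  have E := cardsID [set y] (H :&: P).
  have E1 : (H :&: P) :\: [set y] = T :&: H.
    by apply/setP => B; rewrite /T !inE andbC; case: (B == y); case: (B \in H); case: (B \in P).
  have E2 : #|H :&: P :&: [set y]| = (y \in H).
    case: (boolP (y \in H)) => yH.
      by rewrite (setIidPr _) ?cards1 // sub1set inE yH yP.
    apply/eqP; rewrite cards_eq0; apply/eqP/setP => B; rewrite !inE.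
    by case: eqP => [->|]; rewrite ?(negbTE yH) ?andbF.
  rewrite E1 E2 in E.
  have yH : y \in H by move: E; case: (y \in H) => //; lia.
  exists (T :&: H); last by rewrite subUset sub1set yH subsetIr.
  by split; [apply: subsetIl | rewrite yH in E; lia].
(* If [T] consists of singletons, then [y] and [t - 1] blocks of [T] leave two points to be split
   into two blocks, so the partition is [P] itself, which meets [T] fully. *)
case: (boolP [forall c in T, #|c| == 1]) => [/forall_inP T1|].
  right; exists T => // H HP tH; apply: contraT => nT; have [A [sA cA] sH] := H_split H tH nT.
  have [u [w [uw uP wP E]]] := sPA A sA cA.
  have uwT c : c \in [set u; w] -> #|c| = 1.
    rewrite -E !inE negb_or => /andP[/andP[cy _] cinP]; apply/eqP/T1.
    by rewrite !inE cy.
  suff HE : H = P by move: nT; rewrite HE (setIidPl sTP) cT leqnSn.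
  have : #|above (t + 2) (y |: A)| <= 1.
    have uu : #|u| = 1 by apply: uwT; rewrite !inE eqxx.
    have ww : #|w| = 1 by apply: uwT; rewrite !inE eqxx orbT.
    by rewrite (card_yA A sA cA) E big_setU1 ?inE //= big_set1 uu ww.
  by move/card_le1_eqP; apply; rewrite inE ?HP ?PP //= syA.
rewrite negb_forall_in => /exists_inP[c0 c0T c0_1]; left.
pose DD := [set A : {set {set 'I_n}} | A \subset T & #|A| == t.-1].
have sub : [set H in Pi n (t + 2) | t <= #|H :&: P|] \subset
    meeting t (t + 2) T :|: \bigcup_(A in DD) above (t + 2) (y |: A).
  apply/subsetP => H; rewrite !inE => /andP[HP tH]; rewrite HP /=.
  case: (boolP (t <= #|T :&: H|)) => //= /(H_split H tH)[A [sA cA] sH].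
  by apply/bigcupP; exists A; rewrite !inE ?HP ?sA ?cA ?eqxx.
apply: leq_ltn_trans (subset_leq_card sub) _.
apply: leq_ltn_trans (leq_card_setU _ _) _.
have hM := card_meeting_nonsingleton cT c0T c0_1 PP sTP (leqnn (t + 2)).
rewrite addKn in hM.
set M := 2 ^ (n - t - 2).
(* The blocks [u] and [w] left over are no larger than [y], which is the bound [two_pow_pairs]
   needs. If they have [e + 1] points in total, the count is [2 ^ e - 1]; the added 1 cancels the
   subtraction and later gives strictness. *)
have hA A : A \in DD -> (t + 1) * (#|above (t + 2) (y |: A)| + 1) <= M.
  rewrite inE => /andP[sA /eqP cA]; have [u [w [uw uP wP E]]] := sPA A sA cA.
  rewrite (card_yA A sA cA) E big_setU1 ?inE //= big_set1.
  have := card_partition pP; rewrite cardsT card_ord (big_setID (y |: A)) /= E.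
  rewrite (setIidPr (syA A sA)) [\sum_(_ in [set u; w]) _]big_setU1 ?inE //= big_set1.
  rewrite big_setU1 /=; last by apply: contra yT => /(subsetP sA).
  have := leq_card_sum PP (subset_trans sA sTP); rewrite cA.
  have := ymax u uP; have := ymax w wP.
  have u_gt0 : 0 < #|u| by rewrite card_gt0 (partition_neq0 pP uP).
  move: (\sum_(_ in A) _) => a h1 h2 h3 nE.
  have he : 3 * (#|u| + #|w|) <= 2 * (n - t + 1).
    move: (#|u|) (#|w|) (#|y|) h1 h2 h3 nE t_gt0; clear=> u' w' y' h1 h2 h3 nE t_gt0.
    have {}h1 : w' <= y' by []. have {}h2 : u' <= y' by []. lia.
  have [e eE] : exists e, #|u| + #|w| = e.+1 by exists (#|u| + #|w|).-1; rewrite prednK // addn_gt0 u_gt0.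
  have := two_pow_pairs K3 nK tK he; rewrite eE s2_2 subnK ?expn_gt0 //.
  have -> : 2 ^ (n - t) = 4 * M by rewrite /M -[4]/(2 ^ 2) -expnD; congr (2 ^ _); clear -nl tK; lia.
  rewrite expnS; move: (2 ^ e) M; clear=> X M h.
  rewrite -(@leq_pmul2l 4) //; apply: leq_trans h; lia.
have hS : (t + 1) * (\sum_(A in DD) (#|above (t + 2) (y |: A)| + 1)) <= 'C(t.+1, 2) * M.
  rewrite big_distrr /=; apply: (@leq_trans (\sum_(A in DD) M)); first exact: leq_sum.
  rewrite sum_nat_const /DD cards_draws cT leq_mul2r; apply/orP; right.
  rewrite -bin_sub ?leqW ?leq_pred //.
  by have -> : t.+1 - t.-1 = 2 by clear -t_gt0; lia.
have hU := leq_card_bigcup DD (fun A => above (t + 2) (y |: A)).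
apply: leq_ltn_trans (leq_add hM hU) _; rewrite -addnA ltn_add2l.
have [N NE] : exists N, n - t = N.+2 by exists (n - t - 2); clear -nl tK; lia.
rewrite big_split /= sum1_card in hS.
move: hS; rewrite /M NE !subn1 subn2 /= !s2_2 expnS.
have DD_gt0 : 0 < #|DD| by rewrite /DD cards_draws cT bin_gt0 leqW ?leq_pred.
have X_gt1 : 1 < 2 ^ N by rewrite -{1}[1](expn0 2) ltn_exp2l //; clear -nl tK NE; lia.
have hC : 'C(t.+1, 2) * 2 = t.+1 * t.
  by rewrite bin2 /= muln2; have := odd_double_half (t.+1 * t); rewrite oddM /= andNb.
move: (\sum_(_ in _) _) (2 ^ N) ('C(_, _)) (#|DD|) X_gt1 hC DD_gt0 => S X C d X_gt1 hC d_gt0 hS.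
have {hS hC} hS : 2 * (S + d) <= t * X.
  rewrite -(@leq_pmul2l (t + 1)); last by rewrite addn1.
  rewrite mulnCA; apply: leq_trans (leq_mul (leqnn 2) hS) _.
  by rewrite mulnCA mulnA hC mulnA addn1.
have -> : (2 * X - 1).-1 = (X - 1) + (X - 1) by clear -X_gt1; lia.
rewrite mulnDr ltn_add2l mulnBr muln1.
have : t * 2 <= t * X by rewrite leq_mul2l X_gt1 orbT.
clear -hS d_gt0; lia.
Qed.

End CountMeeting.

(** * Families of partitions *)

(* [weight n t K k s] bounds the number of members of [Pi n k] containing [s] given blocks.
   Since [k - 1] blocks determine a partition into [k] blocks, the counts stop decreasing at
   [s = k - 1]; unless [k = t + 2] the value there is inflated to [2 * K ^ 2], so that consecutive
   weights still decrease by that factor while the values at [t] and [t.+1] remain exact. *)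
Definition weight n t K k s : nat :=
  if s + 2 <= k then s2 (n - s) (k - s)
  else if s.+1 == k then (if k == t + 2 then 1 else 2 * K ^ 2)
  else s == k.

Section Weights.

Variables n t K k : nat.
Hypothesis t_gt0 : 0 < t.
Hypothesis tk : t + 2 <= k.
Hypothesis kK : k <= K.
Hypothesis nK : 32 * K ^ (2 * K) <= 2 ^ (n + K).

Local Lemma K3 : 3 <= K. Proof. lia. Qed.
Local Lemma nl : K + 5 <= n. Proof. exact: n_large K3 nK. Qed.
Local Lemma q_gt0' : 0 < 2 * K ^ 2. Proof. by rewrite muln_gt0 expn_gt0; lia. Qed.

Lemma weight_t : weight n t K k t = s2 (n - t) (k - t).
Proof. by rewrite /weight tk. Qed.

Lemma weight_t1 : weight n t K k t.+1 = s2 (n - t - 1) (k - t - 1).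
Proof.
rewrite /weight; case: (leqP (t.+1 + 2) k) => h; first by rewrite -!subnDA !addn1.
have -> : k = t + 2 by lia.
have -> : t + 2 - t - 1 = 1 by lia.
have [N ->] : exists N, n - t - 1 = N.+1 by exists (n - t - 2); have := nl; lia.
by rewrite addn2 !eqxx s2_1.
Qed.

Lemma weight_t1_gt0 : 0 < weight n t K k t.+1.
Proof. by rewrite weight_t1; apply: s2_gt0; have := nl; lia. Qed.

Lemma card_above_weight (A : {set {set 'I_n}}) : #|above k A| <= weight n t K k #|A|.
Proof.
rewrite /weight; case: (leqP (#|A| + 2) k) => h1; first by apply: card_above_le_card; lia.
case: eqP => h2.
  apply: leq_trans (card_above_le_card _) _; first by lia.
  have -> : k - #|A| = 1 by lia.
  have [N ->] : exists N, n - #|A| = N.+1 by exists (n - #|A|).-1; have := nl; lia.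
  by rewrite s2_1; case: ifP => // _; apply: q_gt0'.
by apply: card_above_le1; lia.
Qed.

Lemma weight_step s : k != t + 2 -> t <= s ->
  2 * K ^ 2 * weight n t K k s.+1 <= weight n t K k s.
Proof.
move=> kt ts; rewrite /weight (negbTE kt).
case: (leqP (s.+1 + 2) k) => h1.
  have -> : s + 2 <= k by lia.
  have := @s2_ratio_growth n K K3 nK k s; rewrite -!subnDA !addn1; apply; lia.
case: eqP => h2.
  have -> : s + 2 <= k by lia.
  have -> : k - s = 2 by lia.
  have [N NE] : exists N, n - s = N.+1 by exists (n - s).-1; have := nl; lia.
  rewrite NE s2_2 mulnn.
  have := two_pow_large K3 nK kK; have -> : (n - k).+1 = N by have := nl; lia.
  by move: (2 ^ N) ((2 * K ^ 2) ^ 2) => a b; lia.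
have -> : (s + 2 <= k) = false by lia.
by case: eqP => _; rewrite ?muln1 ?muln0.
Qed.

(** For [k = t + 2] the weights from [t] on are [S(n - t, 2)], 1, 1, 0, so the first one must pay
    for two factors at once; otherwise [weight_step] is iterated. *)
Lemma weight_geo z : (2 * K ^ 2) ^ z * weight n t K k (t + z) <= weight n t K k t.
Proof.
have [kt|kt] := eqVneq k (t + 2); last first.
  elim: z => [|z IHz]; first by rewrite addn0 mul1n.
  apply: leq_trans IHz; rewrite expnSr -mulnA leq_mul2l addnS.
  by apply/orP; right; apply: weight_step kt _; rewrite leq_addr.
have hQ : (2 * K ^ 2) ^ 2 <= weight n t K k t.
  rewrite weight_t kt; have -> : t + 2 - t = 2 by lia.
  have [N NE] : exists N, n - t = N.+1 by exists (n - t).-1; have := nl; lia.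
  rewrite NE s2_2; have := two_pow_large K3 nK kK.
  have -> : (n - k).+1 = N by have := nl; lia.
  by move: (2 ^ N) ((2 * K ^ 2) ^ 2) => a b; lia.
case: z => [|[|[|z]]]; first by rewrite addn0 mul1n.
- apply: leq_trans hQ; rewrite addn1 /weight kt.
  have -> : (t.+1 + 2 <= t + 2) = false by lia.
  by rewrite addn2 !eqxx muln1; apply: leq_pexp2l; rewrite ?q_gt0'.
- apply: leq_trans hQ; rewrite /weight kt.
  have -> : (t + 2 + 2 <= t + 2) = false by lia.
  have -> : ((t + 2).+1 == t + 2) = false by lia.
  by rewrite eqxx muln1.
rewrite [weight n t K k (t + _)]/weight kt.
have -> : (t + z.+3 + 2 <= t + 2) = false by lia.
have -> : ((t + z.+3).+1 == t + 2) = false by lia.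
have -> : (t + z.+3 == t + 2) = false by lia.
by rewrite muln0.
Qed.

Lemma weight_geo_large x : k != t + 2 ->
  (2 * K ^ 2) ^ x * weight n t K k (t.+1 + x) <= weight n t K k t.+1.
Proof.
move=> kt; elim: x => [|x IHx]; first by rewrite addn0 mul1n.
apply: leq_trans IHx; rewrite expnSr -mulnA leq_mul2l addnS.
by apply/orP; right; apply: weight_step kt _; lia.
Qed.

End Weights.

Lemma prod_eq_of_leq (J : finType) (S : {set J}) (x y : J -> nat) :
    (forall i, i \in S -> x i <= y i) -> 0 < \prod_(i in S) y i ->
    \prod_(i in S) x i = \prod_(i in S) y i -> forall i, i \in S -> x i = y i.
Proof.
move=> xy y_gt0 E i iS; move: y_gt0 E; rewrite !(big_setD1 i iS) /= muln_gt0 => /andP[_ Y_gt0] E.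
have XY : \prod_(j in S :\ i) x j <= \prod_(j in S :\ i) y j.
  by apply: leq_prod => j; rewrite inE => /andP[_ /xy].
by apply/eqP; rewrite eqn_leq xy //= -(leq_pmul2r Y_gt0) -E leq_mul2l XY orbT.
Qed.

Section PartitionFamilies.

Variables (n t K : nat) (I : finType) (k : I -> nat) (F : I -> {set {set {set 'I_n}}}).
Hypothesis t_gt0 : 0 < t.
Hypothesis I_gt2 : 2 < #|I|.
Hypothesis tk : forall i, t + 2 <= k i.
Hypothesis kK : forall i, k i <= K.
Hypothesis nK : 32 * K ^ (2 * K) <= 2 ^ (n + K).
Hypothesis sF : forall i, F i \subset Pi n (k i).
Hypothesis F_ne : forall i, F i != set0.
Hypothesis crossF : cross F [set: I] t.
Hypothesis nontrivF : forall A : {set {set 'I_n}}, #|A| = t ->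
  exists i, exists2 G, G \in F i & ~~ (A \subset G).

Local Notation V i := (s2 (n - t) (k i - t)).
Local Notation W i := (s2 (n - t - 1) (k i - t - 1)).

Local Lemma tK_ : t + 2 <= K.
Proof.
have /card_gt0P[i _] : 0 < #|I| by apply: leq_trans I_gt2.
exact: leq_trans (tk i) (kK i).
Qed.

Local Lemma n_big : K + 5 <= n.
Proof. by apply: n_large nK; have := tK_; lia. Qed.

Local Lemma W_gt0 i : 0 < W i.
Proof. by apply: s2_gt0; have := n_big; have := tk i; have := kK i; lia. Qed.

Local Lemma card_F_above i (A : {set {set 'I_n}}) :
  #|[set G in F i | A \subset G]| <= #|above (k i) A|.
Proof.
apply/subset_leq_card/subsetP => G; rewrite !inE => /andP[GF ->].
by have := subsetP (sF i) G GF; rewrite inE andbT.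
Qed.

Lemma partition_families_bound :
  bound_or_extremal F (fun i => weight n t K (k i)) t.
Proof.
have nb := n_big; have tK := tK_.
have inPi i G : G \in F i -> G \in Pi n (k i) by apply: (subsetP (sF i)).
apply: (@abstract_bound _ _ F _ (fun i => k i == t + 2) t K (2 * K ^ 2)) => //.
- move=> i A; apply: leq_trans (card_F_above i A) _.
  exact: card_above_weight.
- by move=> i; apply: weight_t1_gt0.
- by move=> i z; apply: weight_geo.
- by move=> i x; apply: weight_geo_large.
- move=> a b ka /eqP kb; rewrite !weight_t ?weight_t1 // kb addKn.
  apply: s2_large_small => //; first by lia.
  by rewrite kK andbT; have := tk a; move/eqP: ka; lia.
- move=> i /eqP ki; rewrite weight_t1 // ki.
  have -> : t + 2 - t - 1 = 1 by lia.
  have [N ->] : exists N, n - t - 1 = N.+1 by exists (n - t - 2); lia.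
  exact: s2_1.
- by move=> i G /inPi /PiP[_ ->].
- by move=> i G /eqP ki /inPi /PiP[_ ->].
- move=> b P i /eqP kb /inPi; rewrite kb weight_t1 // => PP.
  apply: leq_trans (@card_near_le n t (k i) P (tk i) _ PP); last by lia.
  by apply/subset_leq_card/subsetP => G; rewrite !inE => /andP[/inPi/PiP[-> ->] ->]; rewrite eqxx.
- move=> a b P /eqP ka /eqP kb /inPi; rewrite kb => PP.
  rewrite /extremal_count !weight_t // weight_t1 // ka.
  have -> : t + 2 - t = 2 by lia.
  have -> : 2 - 1 = 1 by [].
  have -> : s2 (n - t - 1) 1 = 1.
    have [N ->] : exists N, n - t - 1 = N.+1 by exists (n - t - 2); lia.
    exact: s2_1.
  case: (card_near2 nK t_gt0 tK PP) => [lt|[T cT HT]]; [left|right].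
    apply: leq_ltn_trans lt; apply/subset_leq_card/subsetP => H.
    by case/setIdP=> /inPi HP tH; apply/setIdP; rewrite -ka.
  by exists T => // H /inPi; rewrite ka; apply: HT.
Qed.

(** The abstract bound distinguishes some index [a]; the product is then transferred to [b], and
    equality is traced back through the chain of inequalities. *)
Lemma partition_families_max b : (forall i, k b <= k i) ->
  \prod_i #|F i| <= (V b + t * (V b - W b)) * \prod_(i in [set~ b]) W i /\
  (\prod_i #|F i| = (V b + t * (V b - W b)) * \prod_(i in [set~ b]) W i ->
   exists a, exists T : {set {set 'I_n}},
     [/\ k a = k b, #|T| = t.+1, forall B, B \in T -> #|B| = 1,
         F a = meeting t (k a) T & forall i, i != a -> F i = above (k i) T]).
Proof.
move=> kb; have nb := n_big; have tK := tK_.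
pose f i := V i + t * (V i - W i).
have WV i : W i <= V i.
  have [m mE] : exists m, k i - t = m.+1 by exists (k i - t).-1; have := tk i; lia.
  have [N NE] : exists N, n - t = N.+1 by exists (n - t).-1; lia.
  by rewrite NE mE !subn1 /= s2S leq_addl.
have f_gt0 i : 0 < f i.
  by apply: leq_trans (leq_trans (W_gt0 i) (WV i)) (leq_addr _ _).
have fW a : f a * W b <= f b * W a /\ (k a != k b -> f a * W b < f b * W a).
  have [N NE] : exists N, n - t = N.+1 by exists (n - t).-1; lia.
  have [i iE] : exists i, k b - t = i.+1 by exists (k b - t).-1; have := tk b; lia.
  have [j jE] : exists j, k a - t = j.+1 by exists (k a - t).-1; have := tk a; lia.
  have wa := WV a; have wb := WV b.
  have e : forall x y z w : nat, x * w <= y * z -> z <= x -> w <= y ->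
      (x + t * (x - z)) * w <= (y + t * (y - w)) * z.
    move=> x y z w h h1 h2; rewrite !mulnDl -!mulnA !mulnBl [z * w]mulnC.
    by apply: leq_add => //; rewrite leq_mul2l leq_sub2r ?orbT.
  have e' : forall x y z w : nat, x * w < y * z -> z <= x -> w <= y ->
      (x + t * (x - z)) * w < (y + t * (y - w)) * z.
    move=> x y z w h h1 h2; rewrite !mulnDl -!mulnA !mulnBl [z * w]mulnC.
    rewrite -addSn; apply: leq_add => //.
    by rewrite leq_mul2l leq_sub2r ?orbT // ltnW.
  have r0 := @s2_ratio_le N i j; have r1 := @s2_ratio_lt N i j.
  rewrite NE iE jE !subn1 /= in wa wb *; rewrite /f NE iE jE !subn1 /=.
  have kab := kb a; have ka := kK a.
  split=> [|ne]; [apply: e | apply: e'] => //; [apply: r0 | apply: r1]; first by lia.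
  by move/eqP: ne; lia.
have split_b a : \prod_i W i = W a * \prod_(i in [set~ a]) W i by apply: prod_setC1.
have prod_gt0 (J : {set I}) : 0 < \prod_(i in J) W i by apply: prodn_cond_gt0 => i _; apply: W_gt0.
have moveb a : f a * \prod_(i in [set~ a]) W i <= f b * \prod_(i in [set~ b]) W i /\
    (k a != k b -> f a * \prod_(i in [set~ a]) W i < f b * \prod_(i in [set~ b]) W i).
  have Wab : 0 < W a * W b by rewrite muln_gt0 !W_gt0.
  have Ea : f a * \prod_(i in [set~ a]) W i * (W a * W b) = f a * W b * \prod_i W i.
    by rewrite (split_b a); lia.
  have Eb : f b * \prod_(i in [set~ b]) W i * (W a * W b) = f b * W a * \prod_i W i.
    by rewrite (split_b b); lia.
  have P_gt0 : 0 < \prod_i W i by rewrite (split_b a) muln_gt0 W_gt0 prod_gt0.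
  split=> [|ne]; first by rewrite -(leq_pmul2r Wab) Ea Eb leq_pmul2r //; case: (fW a).
  by rewrite -(ltn_pmul2r Wab) Ea Eb ltn_pmul2r //; case: (fW a) => _; apply.
have [a] := partition_families_bound; set w := fun i => weight _ _ _ _.
have wE (J : {set I}) : \prod_(i in J) w i t.+1 = \prod_(i in J) W i.
  by apply: eq_bigr => i _; rewrite /w weight_t1.
have cE : extremal_count w t a = f a by rewrite /extremal_count /w weight_t // weight_t1.
rewrite wE cE => -[lt|[T [cT Ta Ti]]].
  have lt' := leq_trans lt (moveb a).1; split; first exact: ltnW.
  by move=> E; rewrite -/(f b) E ltnn in lt'.
have sA : F a \subset meeting t (k a) T.
  by apply/subsetP => P PF; rewrite inE (subsetP (sF a) P PF) Ta.
have sI i : i != a -> F i \subset above (k i) T.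
  by move=> ia; apply/subsetP => P PF; rewrite inE (subsetP (sF i) P PF) (Ti i).
have cI i : i \in [set~ a] -> #|F i| <= W i.
  rewrite !inE => ia; apply: leq_trans (subset_leq_card (sI i ia)) _.
  apply: leq_trans (card_above_le_card _) _; rewrite cT; first by have := tk i; lia.
  by rewrite !subnS !subn0.
have NJ : \prod_(i in [set~ a]) #|F i| <= \prod_(i in [set~ a]) W i by apply: leq_prod.
(* A block of [T] with more than one point makes [F a] strictly smaller than its bound, so equality
   is then impossible. *)
case: (boolP [forall c in T, #|c| == 1]) => [/forall_inP T1|]; last first.
  rewrite negb_forall_in => /exists_inP[c0 c0T c0_1].
  have /card_gt0P[i0] : 0 < #|[set~ a]| by rewrite cardsC1; lia.
  rewrite !inE => i0a; have [P0 P0F] := set0Pn _ (F_ne i0).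
  have P0P := subsetP (sF i0) P0 P0F.
  have lt : #|F a| < f a.
    apply: leq_ltn_trans (subset_leq_card sA) _.
    apply: (card_meeting_nonsingleton_lt t_gt0 _ cT c0T c0_1 P0P (Ti i0 P0 i0a P0F) (tk a)).
    by have := kK a; lia.
  have lt' : \prod_i #|F i| < f b * \prod_(i in [set~ b]) W i.
    apply: leq_trans (moveb a).1; rewrite (prod_setC1 a).
    by apply: leq_ltn_trans (leq_mul (leqnn _) NJ) _; rewrite ltn_pmul2r.
  by split; [apply: ltnW | move=> E; rewrite -/(f b) E ltnn in lt'].
have T1' B : B \in T -> #|B| = 1 by move/T1/eqP.
have cA : #|meeting t (k a) T| <= f a by apply: card_meeting_singletons.
have Na := leq_trans (subset_leq_card sA) cA.
have Nf : \prod_i #|F i| <= f a * \prod_(i in [set~ a]) W i.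
  by rewrite (prod_setC1 a); apply: leq_mul.
split; first exact: leq_trans Nf (moveb a).1.
(* Equality excludes [k a != k b], where the transfer to [b] is strict, and then forces every factor
   to attain its bound, so the inclusions of families become equalities. *)
rewrite -/(f b) => E; exists a, T.
have ka : k a = k b.
  apply/eqP; apply: contraT => /(moveb a).2; rewrite -E ltnNge; by rewrite Nf.
have Ea : \prod_i #|F i| = f a * \prod_(i in [set~ a]) W i.
  by apply/eqP; rewrite eqn_leq Nf E (moveb a).1.
have Fa : #|F a| = f a.
  apply/eqP; rewrite eqn_leq Na /= -(leq_pmul2r (prod_gt0 [set~ a])) -Ea (prod_setC1 a).
  by rewrite leq_mul2l NJ orbT.
have Ei : \prod_(i in [set~ a]) #|F i| = \prod_(i in [set~ a]) W i.
  by move/eqP: Ea; rewrite (prod_setC1 a) Fa eqn_pmul2l // => /eqP.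
split=> //; first by apply/eqP; rewrite eqEcard sA Fa.
move=> i ia; apply/eqP; rewrite eqEcard sI //=.
rewrite (prod_eq_of_leq cI (prod_gt0 _) Ei) ?inE //.
rewrite card_above_singletons // cT; last by have := tk i; lia.
by rewrite !subnS !subn0.
Qed.

End PartitionFamilies.

(** * The theorem for families indexed by [1, ..., r] *)

Unset Implicit Arguments.

Theorem theorem1p6 (n r t : nat) (k : nat -> nat)
    (F : nat -> {set {set {set 'I_n}}}) :
  0 < n -> 0 < t -> 3 <= r ->
  (forall i j, 1 <= i -> i <= j -> j <= r -> k j <= k i) ->
  t + 2 <= k r ->
  log_cond n (k 1) ->
  (forall i, 1 <= i <= r -> F i \subset Pi n (k i)) ->
  cross_intersecting r t F ->
  nontrivial r t F ->
  (\prod_(1 <= i < r.+1) #|F i| <=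
     ((t + 1) * stirling (n - t) (k r - t) - t * stirling (n - t - 1) (k r - t - 1))
     * \prod_(1 <= i < r) stirling (n - t - 1) (k i - t - 1))
  /\
  (\prod_(1 <= i < r.+1) #|F i| =
     ((t + 1) * stirling (n - t) (k r - t) - t * stirling (n - t - 1) (k r - t - 1))
     * \prod_(1 <= i < r) stirling (n - t - 1) (k i - t - 1) ->
   exists a, exists T : {set {set 'I_n}},
     [/\ 1 <= a <= r /\ k a = k r,
         #|T| = t + 1, (forall B, B \in T -> #|B| = 1),
         F a = [set P in Pi n (k a) | t <= #|T :&: P|] &
         (forall i, 1 <= i <= r -> i != a ->
            F i = [set P in Pi n (k i) | T \subset P])]).
Proof.
move=> _ t_gt0 r3 k_mono tk_r hlog sF crF ntF.
case: r r3 k_mono tk_r sF crF ntF => // r r3 k_mono tk_r sF crF ntF.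
(* Indices are shifted by one to become ordinals; [ord_max] is the last family, which has the least
   [k]. *)
pose K := k 1; pose k' (i : 'I_r.+1) := k i.+1; pose F' (i : 'I_r.+1) := F i.+1.
have tk i : t + 2 <= k' i by apply: leq_trans tk_r (k_mono _ _ _ _ _).
have kK i : k' i <= K by apply: k_mono.
have K_ge : t + 2 <= K := leq_trans (tk ord0) (kK ord0).
have nK : 32 * K ^ (2 * K) <= 2 ^ (n + K) by apply: log_cond_pow => //; lia.
have nb : K + 5 <= n by apply: n_large nK; lia.
have sF' i : F' i \subset Pi n (k' i) by apply: sF; rewrite /= ltn_ord.
rewrite !stirlingE; set V := s2 (n - t) _; set W := s2 (n - t - 1) _.
(* Subtraction is truncated, so regrouping requires [W <= V]. *)
have fE : (t + 1) * V - t * W = V + t * (V - W).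
  have : W <= V.
    have [m mE] : exists m, k r.+1 - t = m.+1 by exists (k r.+1 - t).-1; lia.
    have [N NE] : exists N, n - t = N.+1 by exists (n - t).-1; lia.
    by rewrite /W /V NE mE !subn1 /= s2S leq_addl.
  by move=> WV; rewrite mulnBr mulnDl mul1n addnC addnBA // leq_mul2l WV orbT.
have prodFE : \prod_(1 <= i < r.+2) #|F i| = \prod_i #|F' i| by rewrite big_add1 big_mkord.
have prodWE : \prod_(1 <= i < r.+1) stirling (n - t - 1) (k i - t - 1) =
    \prod_(i in [set~ ord_max]) s2 (n - t - 1) (k' i - t - 1).
  rewrite big_add1 big_mkord [RHS](eq_bigl (fun i => i != ord_max)) => [|i]; last by rewrite !inE.
  rewrite [RHS]big_mkcond [RHS]big_ord_recr /= eqxx muln1.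
  apply: eq_bigr => i _; rewrite stirlingE ifT //.
  by apply: contraTneq (ltn_ord i) => /(congr1 val) /= ->; rewrite ltnn.
rewrite fE prodFE prodWE.
(* An empty family makes the product zero while the bound is positive; the results on selections
   assume nonempty families. *)
case: (boolP [exists i, F' i == set0]) => [/existsP[i /eqP F0]|].
  have -> : \prod_i #|F' i| = 0 by rewrite (bigD1 i) //= F0 cards0.
  split=> // /esym/eqP; rewrite muln_eq0 => /orP[]; rewrite eqn0Ngt => /negP[].
    by rewrite addn_gt0 /V s2_gt0 //; have := kK ord_max; rewrite /k' /=; lia.
  by apply: prodn_cond_gt0 => j _; apply: s2_gt0; have := tk j; have := kK j; lia.
rewrite negb_exists => /forallP F_ne.
have crossF : cross F' [set: 'I_r.+1] t.
  move=> f /selP[fF _]; pose G i := f (inord i.-1).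
  have GF i : 1 <= i <= r.+1 -> G i \in F i.
    move=> ir; have := fF (inord i.-1) (in_setT _); rewrite /F' inordK; last by lia.
    by rewrite prednK //; case/andP: ir.
  have := crF G GF; congr (_ <= #|pred_of_set _|).
  rewrite /inter big_add1 big_mkord; apply: eq_big => [i|i _]; first by rewrite inE.
  by rewrite /G /= inord_val.
have nontrivF (A : {set {set 'I_n}}) : #|A| = t ->
    exists i, exists2 G, G \in F' i & ~~ (A \subset G).
  move=> cA; case: (boolP [exists i, [exists G in F' i, ~~ (A \subset G)]]).
    by case/existsP => i /exists_inP[G GF nA]; exists i, G.
  rewrite negb_exists => /forallP allA; move: ntF; rewrite /nontrivial ltnNge => /negP[].
  rewrite -cA; apply/subset_leq_card/subsetP => B BA; rewrite inE; apply/allP => i.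
  rewrite mem_iota => ir; apply/forall_inP => G GF.
  have i_lt : i.-1 < r.+1 by lia.
  have := allA (Ordinal i_lt); rewrite negb_exists_in => /forall_inP /(_ G).
  rewrite /F' /= prednK; last by lia.
  by move=> /(_ GF); rewrite negbK => /subsetP; apply.
have := @partition_families_max n t K _ k' F' t_gt0 _ tk kK nK sF' F_ne crossF nontrivF ord_max.
case=> [||le eq].
- by rewrite card_ord.
- by move=> i; apply: k_mono.
split=> // /eq[a [T [ka cT T1 Fa Fi]]].
exists a.+1, T; split=> //; first by rewrite /= ltn_ord.
  by rewrite cT addn1.
case=> // i /andP[_ ir] ia.
have ia' : Ordinal ir != a by apply: contraNneq ia => <-.
exact: Fi ia'.
Qed.
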